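(* Let $(\phi_t)_{t\ge 0}$ be a non-elliptic semigroup of holomorphic functions in the unit disk $\mathbb{D}$, let $\Delta$ be a petal of $(\phi_t)$, let $K\subset\Delta$ be compact, and let $n\ge2$ be an integer. Then the hyperbolic $n$-th diameter $d_{n,h}^{\mathbb{D}}(\phi_t(K))$ is a decreasing function of $t\le0$.
   Context: $\mathbb{D}$ is the open unit disk. A (one-parameter) semigroup of holomorphic functions in $\mathbb{D}$ is a family $(\phi_t)_{t\ge0}$ of holomorphic maps $\phi_t:\mathbb{D}\to\mathbb{D}$ such that $\phi_0$ is the identity, $\phi_{t+s}=\phi_t\circ\phi_s$ for all $s,t\ge0$, and $\phi_t(z)\to z$ as $t\to0^+$ uniformly on compact subsets of $\mathbb{D}$. It is called non-elliptic if there is a point $\tau\in\partial\mathbb{D}$ (the Denjoy–Wolff point) with $\lim_{t\to+\infty}\phi_t(z)=\tau$ for every $z\in\mathbb{D}$. A non-elliptic semigroup is called parabolic if the angular derivatives satisfy $\phi_t'(\tau)=1$. Let $d_{\mathbb{D}}(z,w)=\operatorname{arctanh}\left|\frac{z-w}{1-\bar z w}\right|$ be the hyperbolic distance. A backward orbit of $(\phi_t)$ starting at a point $z\in\mathbb{D}$ is a continuous curve $\gamma:[0,+\infty)\to\mathbb{D}$ with $\gamma(0)=z$ and $\phi_s(\gamma(t))=\gamma(t-s)$ for all $t\ge0$, $s\in[0,t]$; it is regular if $\limsup_{t\to+\infty}d_{\mathbb{D}}(\gamma(t),\gamma(t+1))<+\infty$. The backward invariant set is $\mathcal{W}=\bigcap_{t\ge0}\phi_t(\mathbb{D})$.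 A petal $\Delta$ of $(\phi_t)$ is a non-empty simply connected component of the interior of $\mathcal{W}$ such that: (i) $\phi_t(\Delta)=\Delta$ for all $t\ge0$ and $(\phi_t|_{\Delta})$ is a group of automorphisms of $\Delta$; (ii) $\tau\in\partial\Delta$; (iii) there is a point $\sigma\in\partial\mathbb{D}\cap\partial\Delta$ (possibly $\sigma=\tau$) such that for every $z\in\Delta$ the curve $[0,+\infty)\ni t\mapsto(\phi_t|_\Delta)^{-1}(z)$ is a regular backward orbit for $(\phi_t)$ converging to $\sigma$; moreover $\sigma$ is a boundary regular fixed point (a boundary fixed point at which each $\phi_t$ has finite angular derivative), and if $\sigma=\tau$ then the semigroup is parabolic. For $t>0$ and $z\in\Delta$ one writes $\phi_{-t}(z):=(\phi_t|_\Delta)^{-1}(z)$, so $\phi_t$ is defined on $\Delta$ for all $t\in\mathbb{R}$. For a compact set $E\subset\mathbb{D}$ and an integer $n\ge2$, the hyperbolic $n$-th diameter is $$d_{n,h}^{\mathbb{D}}(E)=\sup_{w_1,\dots,w_n\in E}\ \prod_{1\le\mu<\nu\le n}\left|\frac{w_\mu-w_\nu}{1-\overline{w_\mu}w_\nu}\right|^{\frac{2}{n(n-1)}}$$ (the supremum over the empty set being $0$). ''Decreasing'' is meant in the non-strict sense. *)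

(* Defs.v *)
From mathcomp Require Import all_boot all_order all_algebra.
From mathcomp Require Import all_classical all_reals all_analysis.
From mathcomp Require Export complex.

Set Implicit Arguments.
Unset Strict Implicit.
Unset Printing Implicit Defensive.

Import Order.TTheory GRing.Theory Num.Theory.
Import numFieldNormedType.Exports.

Local Open Scope classical_set_scope.
Local Open Scope ring_scope.

(* The topological and normed structures of a numFieldType K are found on the
   regular module K^o; on R[i]^o they give the usual topology of the complex
   plane, and the scalars (hence the increments in [derivable]) are complex. *)
Notation Cplx R := (R[i]%C^o) (only parsing).

Section Plane.
Context {R : realType}.
Implicit Types (z w : Cplx R) (f : Cplx R -> Cplx R) (U : set (Cplx R)).

(* The norm `|z| of R[i] takes its values in R[i]; this is its value in R. *)
Definition cabs z : R := ComplexField.Normc.normc z.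

Definition unit_disk : set (Cplx R) := [set z | cabs z < 1].

Definition unit_circle : set (Cplx R) := [set z | cabs z = 1].

Definition frontier U : set (Cplx R) := closure U `\` interior U.

(* Only used for open U, where the complex difference quotients at a point of
   U eventually involve values of f on U only. *)
Definition holomorphic_on U f := forall z, U z -> derivable f z (1 : Cplx R).

(* Inverse of the restriction f|_U (unspecified outside of f @` U). *)
Definition restr_inv U f : Cplx R -> Cplx R := 'pinv_(fun=> 0) U f.

Definition automorphism U f :=
  [/\ set_bij U U f, holomorphic_on U f & holomorphic_on U (restr_inv U f)].

Definition path_connected U := forall x y, U x -> U y ->
  exists c : R -> Cplx R,
    [/\ {within `[0, 1]%classic, continuous c},
        forall s : R, 0 <= s <= 1 -> U (c s), c 0 = x & c 1 = y].

(* Every loop c in U is homotopic in U to a constant loop, with fixed base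
   point; the first variable of H is the parameter of the homotopy. *)
Definition loops_contractible U := forall c : R -> Cplx R,
  {within `[0, 1]%classic, continuous c} ->
  (forall s : R, 0 <= s <= 1 -> U (c s)) -> c 0 = c 1 ->
  exists H : R * R -> Cplx R,
    [/\ {within (`[0, 1] `*` `[0, 1])%classic, continuous H},
        forall r s : R, 0 <= r <= 1 -> 0 <= s <= 1 -> U (H (r, s)),
        forall s : R, 0 <= s <= 1 -> H (0, s) = c s,
        forall s : R, 0 <= s <= 1 -> H (1, s) = c 0 &
        forall r : R, 0 <= r <= 1 -> H (r, 0) = c 0 /\ H (r, 1) = c 0].

Definition simply_connected U := path_connected U /\ loops_contractible U.

Definition component_of U (A : set (Cplx R)) :=
  exists2 z, A z & U = connected_component A z.

Definition pseudo_hyp z w : R := cabs ((z - w) / (1 - conjc z * w)).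

Definition artanh (x : R) : R := ln ((1 + x) / (1 - x)) / 2.

Definition hyp_dist z w : R := artanh (pseudo_hyp z w).

(* [sup] is 0 on the empty set. For n >= 2 the exponent is positive, so that
   0 `^ _ = 0. *)
Definition hyp_diam (n : nat) (E : set (Cplx R)) : R :=
  sup [set \prod_(i < n) \prod_(j < n | (i < j)%N)
             pseudo_hyp (w i) (w j) `^ (2 / (n%:R * (n%:R - 1)))
      | w in [set w : 'I_n -> Cplx R | forall i, E (w i)]].

(* Non-tangential approach regions of the unit disk at a boundary point. *)
Definition stolz (sigma : Cplx R) (M : R) : set (Cplx R) :=
  [set z | unit_disk z /\ cabs (sigma - z) < M * (1 - cabs z)].

Definition angular_limit f (sigma l : Cplx R) := forall M : R, 1 < M ->
  f z @[z --> within (stolz sigma M) (nbhs sigma)] --> l.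

Definition angular_derivative f (sigma l : Cplx R) :=
  exists2 eta : Cplx R, angular_limit f sigma eta &
    angular_limit (fun z => (f z - eta) / (z - sigma)) sigma l.

End Plane.

Section Semigroup.
Context {R : realType}.
(* Only the values phi t z with 0 <= t and z in the unit disk matter. *)
Variable phi : R -> Cplx R -> Cplx R.

Record hol_semigroup : Prop := HolSemigroup {
  semigroup_disk : forall (t : R) z, 0 <= t -> unit_disk z ->
    unit_disk (phi t z);
  semigroup_hol : forall t : R, 0 <= t -> holomorphic_on unit_disk (phi t);
  semigroup0 : forall z, unit_disk z -> phi 0 z = z;
  semigroupD : forall (t s : R) z, 0 <= t -> 0 <= s -> unit_disk z ->
    phi (t + s) z = phi t (phi s z);
  semigroup_cvg0 : forall K : set (Cplx R), compact K -> K `<=` unit_disk ->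
    {uniform K, phi t @[t --> 0^'+] --> (id : Cplx R -> Cplx R)} }.

Definition denjoy_wolff_point (tau : Cplx R) :=
  unit_circle tau /\
  forall z, unit_disk z -> phi t z @[t --> +oo] --> tau.

Definition non_elliptic := exists tau, denjoy_wolff_point tau.

Definition parabolic := exists2 tau, denjoy_wolff_point tau &
  forall t : R, 0 <= t -> angular_derivative (phi t) tau 1.

Definition boundary_regular_fixed_point (sigma : Cplx R) :=
  unit_circle sigma /\ forall t : R, 0 <= t ->
    angular_limit (phi t) sigma sigma /\
    exists l : Cplx R, angular_derivative (phi t) sigma l.

Definition backward_orbit (z : Cplx R) (c : R -> Cplx R) :=
  [/\ {within `[0, +oo[%classic, continuous c},
      forall t : R, 0 <= t -> unit_disk (c t),
      c 0 = z &
      forall t s : R, 0 <= s <= t -> phi s (c t) = c (t - s)].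

Definition regular_backward_orbit (z : Cplx R) (c : R -> Cplx R) :=
  backward_orbit z c /\
  (limf_esup (fun t : R => (hyp_dist (c t) (c (t + 1)))%:E) +oo%R < +oo)%E.

Definition backward_invariant_set : set (Cplx R) :=
  \bigcap_(t in [set t : R | 0 <= t]) (phi t @` unit_disk).

(* phi_t on Delta for every real t: phi_t is (phi_{-t}|_Delta)^-1 if t < 0. *)
Definition petal_flow (Delta : set (Cplx R)) (t : R) : Cplx R -> Cplx R :=
  if 0 <= t then phi t else restr_inv Delta (phi (- t)).

Definition group_of_automorphisms (Delta : set (Cplx R)) :=
  (forall t, automorphism Delta (petal_flow Delta t)) /\
  (forall t s z, Delta z ->
     petal_flow Delta (t + s) z = petal_flow Delta t (petal_flow Delta s z)).

Definition petal (Delta : set (Cplx R)) :=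
  [/\ Delta !=set0,
      simply_connected Delta &
      component_of Delta (interior backward_invariant_set)] /\
  [/\ forall t : R, 0 <= t -> phi t @` Delta = Delta,
      group_of_automorphisms Delta &
      exists tau : Cplx R,
      [/\ denjoy_wolff_point tau,
          frontier Delta tau &
          exists sigma : Cplx R,
          [/\ unit_circle sigma /\ frontier Delta sigma,
              forall z, Delta z ->
                regular_backward_orbit z (fun t => petal_flow Delta (- t) z) /\
                petal_flow Delta (- t) z @[t --> +oo] --> sigma,
              boundary_regular_fixed_point sigma &
              sigma = tau -> parabolic]]].

End Semigroup.

(* Main.v *)
Require Import Defs.
From mathcomp Require Import all_boot all_order all_algebra.
From mathcomp Require Import all_classical all_reals all_analysis.
From mathcomp Require Import ring lra.
Import Order.TTheory GRing.Theory Num.Theory.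
Import numFieldNormedType.Exports.

Local Open Scope classical_set_scope.
Local Open Scope ring_scope.

(** The flow of the petal satisfies phi_t = phi_(t-s) o phi_s on Delta for
    s <= t <= 0, and phi_(t-s) is a holomorphic self-map of the disk. By the
    Schwarz-Pick lemma it does not increase any of the pseudo-hyperbolic
    distances whose geometric mean is maximised in the n-th diameter, so
    phi_t(K), the image of phi_s(K) under it, has the smaller diameter
    ([hyp_diam_contraction], [Schwarz_Pick]).

    What needs work is the Schwarz lemma for functions that are only assumed to
    have a complex derivative at each point, with no continuity of the
    derivative. Let f be such a self-map of the disk with f(0) = 0, and let
    g(z) = f(z)/z, g(0) = f'(0); then g is continuous in the disk and has a
    derivative off 0. The claim |g| <= 1 follows from a maximum principle, in
    three steps.

    Goursat: the integral of g over the boundary of a rectangle is an additive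
    function of the rectangle, and it is o(area) near each point where g has a
    derivative, so it vanishes ([square_additive_eq0]); a corner where g is only
    continuous does no harm ([square_additive_corner_eq0]). Integrals along
    horizontal and vertical segments are increments of antiderivatives A and B
    in these two directions, so additivity is an algebraic identity and all
    estimates come from the mean value inequality. Hence g has a primitive G in
    each smaller disk ([punctured_primitive]).

    Maximum principle: for a second-order Taylor polynomial P, the mean of P over
    the four points z + t, z + it, z - t, z - it is P(z). As G' = g has a
    derivative off 0, the four-point mean of G deviates from G(z) by o(t^2)
    there ([four_sum_primitive]). A continuous q with this property has no
    interior maximum of Re(c q) + eps |z|^2, because the four-point mean of
    |z|^2 exceeds its central value by t^2. At finitely many exceptional points
    e, where q merely has a derivative, the deviation is o(t), and the added
    term eps |z - e|, whose four-point mean at e exceeds its value by t, still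
    excludes a maximum ([maximum_principle]).

    Conclusion: the difference quotient q(z) = (G(z+h) - G(z))/h has this
    property, with exceptional points 0 and -h. It is an average of g over the
    segment from z to z + h, so near the unit circle |q| is at most about 1; it
    tends to g as h -> 0 ([Schwarz_lemma]). *)

(** * Modulus, directional and complex derivatives *)

Section ComplexModulus.
Context {R : realType}.
Implicit Types (z w u : R[i]) (x y : R).

Lemma cabs0 : cabs (0 : R[i]) = 0.
Proof. exact: ComplexField.Normc.normc0. Qed.

Lemma cabs1 : cabs (1 : R[i]) = 1.
Proof. exact: ComplexField.Normc.normc1. Qed.

Lemma cabsM z w : cabs (z * w) = cabs z * cabs w.
Proof. exact: ComplexField.Normc.normcM. Qed.

Lemma cabsV z : cabs z^-1 = (cabs z)^-1.
Proof. exact: ComplexField.Normc.normcV. Qed.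

Lemma cabsN z : cabs (- z) = cabs z.
Proof. exact: normcN. Qed.

Lemma cabsD z w : cabs (z + w) <= cabs z + cabs w.
Proof. exact: le_normcD. Qed.

Lemma cabs_eq0 z : (cabs z == 0) = (z == 0).
Proof.
apply/eqP/eqP => [|->]; [exact: ComplexField.Normc.eq0_normc|exact: cabs0].
Qed.

Lemma cabs_ge0 z : 0 <= cabs z.
Proof. by case: z => a b; exact: sqrtr_ge0. Qed.

Lemma cabs_gt0 z : (0 < cabs z) = (z != 0).
Proof. by rewrite lt_def cabs_ge0 cabs_eq0 andbT. Qed.

Lemma cabsB z w : cabs (z - w) = cabs (w - z).
Proof. by rewrite -cabsN opprB. Qed.

Lemma cabs_sqr z : cabs z ^+ 2 = complex.Re z ^+ 2 + complex.Im z ^+ 2.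
Proof. by case: z => a b /=; rewrite sqr_sqrtr ?addr_ge0 ?sqr_ge0. Qed.

Lemma cabs_real x : cabs x%:C%C = `|x|.
Proof. by rewrite /cabs /= expr0n addr0 sqrtr_sqr. Qed.

Lemma cabs_i : cabs ('i%C : R[i]) = 1.
Proof. by rewrite /cabs /= expr0n add0r expr1n sqrtr1. Qed.

Lemma mul_ii : 'i%C * 'i%C = -1 :> R[i].
Proof. by rewrite -expr2 sqr_i. Qed.

Lemma cabs_conj z : cabs (conjc z) = cabs z.
Proof. by case: z => a b; rewrite /cabs /= sqrrN. Qed.

Lemma conjM_cabs z : conjc z * z = (cabs z ^+ 2)%:C%C.
Proof.
rewrite cabs_sqr; case: z => a b /=.
by apply/eqP; rewrite eq_complex /=; apply/andP; split; apply/eqP; ring.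
Qed.

Lemma Re_le_cabs z : `|complex.Re z| <= cabs z.
Proof.
rewrite -[_ <= _](@ler_pXn2r _ 2) ?nnegrE ?cabs_ge0// cabs_sqr real_normK ?num_real//.
by rewrite lerDl sqr_ge0.
Qed.

Lemma Im_le_cabs z : `|complex.Im z| <= cabs z.
Proof.
rewrite -[_ <= _](@ler_pXn2r _ 2) ?nnegrE ?cabs_ge0// cabs_sqr real_normK ?num_real//.
by rewrite lerDr sqr_ge0.
Qed.

Lemma cabs_le_ReIm z : cabs z <= `|complex.Re z| + `|complex.Im z|.
Proof.
rewrite {1}(complexE z) (le_trans (cabsD _ _))// cabsM cabs_i mul1r.
by rewrite -!cabs_real.
Qed.

Lemma ReB z w : complex.Re (z - w) = complex.Re z - complex.Re w.
Proof. by case: z; case: w. Qed.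

Lemma ReD z w : complex.Re (z + w) = complex.Re z + complex.Re w.
Proof. by case: z; case: w. Qed.

Lemma ImB z w : complex.Im (z - w) = complex.Im z - complex.Im w.
Proof. by case: z; case: w. Qed.

Lemma ImD z w : complex.Im (z + w) = complex.Im z + complex.Im w.
Proof. by case: z; case: w. Qed.

Lemma ler_distc z w : `|cabs z - cabs w| <= cabs (z - w).
Proof.
rewrite ler_norml; apply/andP; split.
  have := cabsD z (w - z); rewrite addrCA subrr addr0 (cabsB w) => h; lra.
have := cabsD w (z - w); rewrite addrCA subrr addr0 => h; lra.
Qed.
End ComplexModulus.

Section Derivatives.
Context {R : realType}.
Implicit Types (f g : R[i] -> R[i]) (z w l v : R[i]).

(** The notions below are stated with explicit radii because the estimates of
    Goursat type choose them by hand, and with the real-valued modulus so that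
    real arithmetic applies. *)
Definition continuous_pt f z := forall e : R, 0 < e -> exists2 d : R, 0 < d &
  forall h, cabs h < d -> cabs (f (z + h) - f z) <= e.

Definition has_cderiv f z l := forall e : R, 0 < e -> exists2 d : R, 0 < d &
  forall h, cabs h < d -> cabs (f (z + h) - f z - l * h) <= e * cabs h.

(** The difference quotient at z along real multiples of the vector v: the
    derivative of a curve, with which f need not be complex differentiable. *)
Definition has_dderiv f z v l := forall e : R, 0 < e -> exists2 d : R, 0 < d &
  forall x : R, `|x| < d ->
    cabs (f (z + x%:C%C * v) - f z - l * x%:C%C) <= e * `|x|.

Lemma is_derive_eps (u : R -> R) (x l : R) :
  (forall e : R, 0 < e -> exists2 d : R, 0 < d & forall h, `|h| < d ->
     `|u (x + h) - u x - l * h| <= e * `|h|) <-> is_derive x 1 u l.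
Proof.
split => [H|ud].
  suff cu : (fun h => h^-1 *: (u (h *: (1 : R) + x) - u x)) @ 0^' --> l.
    apply: DeriveDef; first by apply/cvg_ex; exists l.
    by rewrite /derive; apply/cvg_lim => //; exact: cvg_trans cu.
  apply/cvgrPdist_le => e e0; have [d d0 Hd] := H e e0.
  near=> h.
  have h0 : h != 0 by near: h; exact: nbhs_dnbhs_neq.
  have hd : `|h| < d by near: h; apply: dnbhs0_lt.
  have := Hd h hd.
  have -> : u (x + h) - u x - l * h =
    - ((l - h^-1 *: (u (h *: (1:R) + x) - u x)) * h).
    by rewrite /GRing.scale /= mulr1 (addrC h); field.
  by rewrite normrN normrM ler_pM2r// normr_gt0.
move=> e e0.
have cu : (fun h => h^-1 *: (u (h *: (1 : R) + x) - u x)) @ 0^' --> l.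
  have := @ex_derive _ _ _ _ _ _ _ ud.
  by rewrite -(@derive_val _ _ _ _ _ _ _ ud).
move/cvgrPdist_le : cu => /(_ e e0).
rewrite near_withinE => -[d /= d0 Hd].
exists d => // h hd; have [->|h0] := eqVneq h 0.
  by rewrite addr0 mulr0 subrr subr0 normr0 mulr0.
have := Hd h; rewrite /ball_ /= sub0r normrN => /(_ hd h0).
have -> : u (x + h) - u x - l * h =
  - ((l - h^-1 *: (u (h *: (1:R) + x) - u x)) * h).
  by rewrite /GRing.scale /= mulr1 (addrC h); field.
by rewrite normrN normrM ler_pM2r// normr_gt0.
Unshelve. all: by end_near. Qed.

Lemma Re_increment (u a b l c : R[i]) (x h : R) :
  complex.Re (u * (a - (x%:C%C + h%:C%C) * c)) - complex.Re (u * (b - x%:C%C * c))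
    - complex.Re (u * (l - c)) * h = complex.Re (u * (a - b - l * h%:C%C)).
Proof. by case: u a b l c => u1 u2 [a1 a2] [b1 b2] [l1 l2] [c1 c2] /=; ring. Qed.

(** There is no mean value equality for complex-valued curves; projecting on the
    direction of the total increment w, by Re(conj w * _), reduces the inequality
    to the real mean value theorem with no loss in the constant. *)
Lemma mean_value_le f z v (l : R -> R[i]) c (M : R) :
  (forall x : R, 0 <= x <= 1 -> has_dderiv f (z + x%:C%C * v) v (l x)) ->
  (forall x : R, 0 <= x <= 1 -> cabs (l x - c) <= M) ->
  cabs (f (z + v) - f z - c) <= M.
Proof.
move=> fd lM; set w := f (z + v) - f z - c.
pose u (x : R) := complex.Re (conjc w * (f (z + x%:C%C * v) - x%:C%C * c)).
have ud (x : R) : 0 <= x <= 1 -> is_derive x 1 u (complex.Re (conjc w * (l x - c))).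
  move=> x01; apply/is_derive_eps => e e0.
  have e'0 : 0 < e / (cabs w + 1) by rewrite divr_gt0// ltr_wpDl// cabs_ge0.
  have [d d0 Hd] := fd x x01 _ e'0; exists d => // h hd.
  have := Hd h hd => Hh.
  have -> : u (x + h) - u x - complex.Re (conjc w * (l x - c)) * h =
    complex.Re (conjc w * (f (z + x%:C%C * v + h%:C%C * v) - f (z + x%:C%C * v)
      - l x * h%:C%C)).
    rewrite /u (_ : (x + h)%:C%C = x%:C%C + h%:C%C); last by rewrite rmorphD.
    rewrite mulrDl addrA.
    exact: Re_increment.
  rewrite (le_trans (Re_le_cabs _))// cabsM cabs_conj.
  rewrite (le_trans (ler_wpM2l (cabs_ge0 _) Hh))//.
  rewrite mulrA ler_wpM2r// mulrCA ger_pMr// ler_pdivrMr ?mul1r ?ltr_wpDl ?cabs_ge0//.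
  by rewrite lerDl.
have [x x01 ux] : exists2 x : R, x \in `[(0:R), 1] &
    u 1 - u 0 = complex.Re (conjc w * (l x - c)) * (1 - 0).
  apply: MVT_segment => // [x|].
    by rewrite in_itv /= => /andP[x0 x1]; apply: ud; rewrite !ltW.
  apply: derivable_within_continuous => x; rewrite in_itv /= => /ud h.
  exact: ex_derive.
have : cabs w ^+ 2 <= cabs w * M.
  have -> : cabs w ^+ 2 = u 1 - u 0.
    have -> : cabs w ^+ 2 = complex.Re (conjc w * w) by rewrite conjM_cabs.
    by rewrite /u -ReB -mulrBr /w rmorph1 rmorph0 !mul1r !mul0r addr0 subr0 addrAC.
  rewrite ux subr0 mulr1 (le_trans (ler_norm _))// (le_trans (Re_le_cabs _))//.
  by rewrite cabsM cabs_conj ler_wpM2l ?cabs_ge0// lM.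
have [->|w0] := eqVneq w 0.
  have := lM 0; rewrite lexx ler01 => /(_ isT) => h _.
  by rewrite cabs0 (le_trans _ h)// cabs_ge0.
by rewrite expr2 ler_pM2l// cabs_gt0.
Qed.

End Derivatives.

(** * Additive functions of squares *)

Section AdditiveSquares.
Context {R : realType}.

Lemma nested_intervals (s e : nat -> R) :
  (forall n, s n <= s n.+1) -> (forall n, s n.+1 + e n.+1 <= s n + e n) ->
  (forall n, 0 <= e n) -> exists x, forall n, s n <= x <= s n + e n.
Proof.
move=> s_incr se_decr e_ge0.
have sle m n : (m <= n)%N -> s m <= s n.
  by move=> mn; move/nondecreasing_seqP: s_incr => /(_ m n mn).
have sele m n : (m <= n)%N -> s n + e n <= s m + e m.
  by move=> mn; move/(nonincreasing_seqP (fun n => s n + e n)): se_decr => /(_ m n mn).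
have ub m n : s m <= s n + e n.
  rewrite (le_trans (sle _ _ (leq_maxl m n)))// (le_trans _ (sele _ _ (leq_maxr m n)))//.
  by rewrite lerDl.
have s0 : has_sup (range s).
  by split; [exists (s 0%N), 0%N|exists (s 0%N + e 0%N) => _ [n _ <-]].
exists (sup (range s)) => n; apply/andP; split.
  by apply: ub_le_sup; [case: s0|exists n].
by apply: ge_sup => [|_ [m _ <-]//]; exists (s 0%N), 0%N.
Qed.

(** mu s t e stands for the value of a set function on the square
    [s, s + e] x [t, t + e]. *)
Definition square_additive (mu : R -> R -> R -> R[i]) := forall s t e,
  mu s t e = mu s t (e / 2) + mu (s + e / 2) t (e / 2)
    + mu s (t + e / 2) (e / 2) + mu (s + e / 2) (t + e / 2) (e / 2).

(** mu is o(area) on the squares that shrink to the point (s, t), which they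
    contain but need not have as a corner. *)
Definition square_negligible (mu : R -> R -> R -> R[i]) s t :=
  forall eps : R, 0 < eps -> exists2 d : R, 0 < d &
    forall a b e, 0 < e < d -> a <= s <= a + e -> b <= t <= b + e ->
      cabs (mu a b e) <= eps * e ^+ 2.

(** If |mu| = k e0^2 > 0 on a square of side e0, then one of its four quarters
    again satisfies |mu| >= k e^2. Repeated quartering yields nested squares that
    shrink to one point and there contradict |mu| <= (k/2) e^2. *)
Lemma square_additive_eq0 mu s0 t0 (e0 : R) : square_additive mu -> 0 < e0 ->
  (forall s t, s0 <= s <= s0 + e0 -> t0 <= t <= t0 + e0 ->
     square_negligible mu s t) ->
  mu s0 t0 e0 = 0.
Proof.
move=> mu_add e0_gt0 mu_neg; apply/eqP/negPn/negP => mu0.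
pose k := cabs (mu s0 t0 e0) / e0 ^+ 2.
have k0 : 0 < k by rewrite divr_gt0 ?cabs_gt0// exprn_gt0.
pose bad (p : R * R * R) := (k * p.2 ^+ 2 <= cabs (mu p.1.1 p.1.2 p.2)) && (0 < p.2).
pose sub (p q : R * R * R) :=
  [/\ q.2 = p.2 / 2, p.1.1 <= q.1.1 <= p.1.1 + p.2 / 2 & p.1.2 <= q.1.2 <= p.1.2 + p.2 / 2].
have /choice[step stepP] : forall p, exists q, bad p -> bad q /\ sub p q.
  move=> [[s t] e]; have [|] := boolP (bad _); last by exists (s, t, e).
  rewrite /bad /= => /andP[bp e_gt0].
  pose small (a b : R) := cabs (mu a b (e / 2)) < k * (e / 2) ^+ 2.
  have e2 : 0 < e / 2 by rewrite divr_gt0.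
  suff : ~~ [&& small s t, small (s + e / 2) t, small s (t + e / 2) &
               small (s + e / 2) (t + e / 2)].
    rewrite !negb_and /small -!leNgt => /or4P[] h;
    [exists (s, t, e / 2)|exists (s + e / 2, t, e / 2)|
     exists (s, t + e / 2, e / 2)|exists (s + e / 2, t + e / 2, e / 2)] => _;
    by rewrite /bad /sub /= h; do !split=> //; lra.
  apply/negP => /and4P[]; rewrite /small => h1 h2 h3 h4; move: bp; rewrite mu_add.
  move: h1 h2 h3 h4; set m1 := mu _ _ _; set m2 := mu _ _ _; set m3 := mu _ _ _; set m4 := mu _ _ _.
  have := cabsD (m1 + m2 + m3) m4; have := cabsD (m1 + m2) m3; have := cabsD m1 m2.
  have -> : k * (e / 2) ^+ 2 = k * e ^+ 2 / 4 by field.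
  lra.
pose p n := iter n step (s0, t0, e0).
have bad0 : bad (p 0%N) by rewrite /bad /= e0_gt0 andbT /k divfK// gt_eqF// exprn_gt0.
have badp n : bad (p n) by elim: n => // n /stepP[].
have subp n : sub (p n) (p n.+1) by case: (stepP _ (badp n)).
have pe n : 0 < (p n).2 by case/andP: (badp n).
have [s sP] : exists s, forall n, (p n).1.1 <= s <= (p n).1.1 + (p n).2.
  by apply: nested_intervals => n; [..|exact: ltW]; case: (subp n) => e2 h1 h2; rewrite /= ?e2; lra.
have [t tP] : exists t, forall n, (p n).1.2 <= t <= (p n).1.2 + (p n).2.
  by apply: nested_intervals => n; [..|exact: ltW]; case: (subp n) => e2 h1 h2; rewrite /= ?e2; lra.
have k2 : 0 < k / 2 by rewrite divr_gt0.
have [d d0 dP] := mu_neg _ _ (sP 0%N) (tP 0%N) _ k2.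
have [n nd] : exists n, (p n).2 < d.
  have pE n : (p n).2 = e0 * 2^-1 ^+ n.
    by elim: n => [|n IH]; [rewrite mulr1|case: (subp n) => -> _ _; rewrite IH exprSr mulrA].
  have /cvgrPdist_lt/(_ _ d0)[n _ /(_ n)] : e0 * 2^-1 ^+ n @[n --> \oo] --> (0 : R).
    rewrite -(mulr0 e0); apply: cvgMr; apply: cvg_expr.
    by rewrite ger0_norm ?invr_ge0// invf_lt1// ltr1n.
  by rewrite /= leqnn => /(_ isT); rewrite -pE sub0r normrN gtr0_norm//; exists n.
have /andP[bn en] := badp n.
have := dP (p n).1.1 (p n).1.2 (p n).2; rewrite en nd => /(_ isT (sP n) (tP n)).
have : 0 < k * (p n).2 ^+ 2 by rewrite mulr_gt0// exprn_gt0.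
lra.
Qed.

(** Of the four quarters of a square with corner (0, 0), three avoid that corner
    and carry no mass; so mu is the same on all the squares [0, 2^-n]^2, and
    this common value is the limit 0. *)
Lemma square_additive_corner_eq0 mu : square_additive mu ->
  (forall s t, 0 <= s <= 1 -> 0 <= t <= 1 -> 0 < s + t -> square_negligible mu s t) ->
  (forall eps : R, 0 < eps -> exists2 d : R, 0 < d &
     forall e, 0 < e < d -> cabs (mu 0 0 e) <= eps) ->
  mu 0 0 1 = 0.
Proof.
move=> mu_add mu_neg mu0.
have muE n : mu 0 0 1 = mu 0 0 (2^-1 ^+ n) /\ 2^-1 ^+ n <= (1 : R).
  elim: n => [|n [-> le1]]; first by rewrite expr0.
  set e : R := 2^-1 ^+ n in le1 *.
  have e0 : 0 < e by rewrite exprn_gt0// invr_gt0.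
  have eE : 2^-1 ^+ n.+1 = e / 2 by rewrite exprSr.
  rewrite eE; move: e0 le1 {eE}; move: e => e e0 le1; split; last lra.
  have mu_off a b : 0 <= a <= e / 2 -> 0 <= b <= e / 2 -> 0 < a + b ->
      mu a b (e / 2) = 0.
    move=> ha hb ab; apply: square_additive_eq0 => [||s t hs ht]; [exact: mu_add|by rewrite divr_gt0|].
    move: hs ht => /andP[? ?] /andP[? ?]; move: ha hb => /andP[? ?] /andP[? ?].
    by apply: mu_neg; try (apply/andP; split); lra.
  by rewrite mu_add !add0r (mu_off (e / 2) 0) ?(mu_off 0 (e / 2)) ?(mu_off (e / 2) (e / 2)) ?addr0//; lra.
apply/eqP; rewrite -cabs_eq0 eq_le cabs_ge0 andbT; apply/ler_addgt0Pr => eps eps0.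
rewrite add0r; have [d d0 dP] := mu0 _ eps0.
have [n nd] : exists n, 2^-1 ^+ n < d.
  have /cvgrPdist_lt/(_ _ d0)[n _ /(_ n)] : 2^-1 ^+ n @[n --> \oo] --> (0 : R).
    by apply: cvg_expr; rewrite ger0_norm ?invr_ge0// invf_lt1// ltr1n.
  rewrite /= leqnn => /(_ isT); rewrite sub0r normrN gtr0_norm ?exprn_gt0 ?invr_gt0//.
  by exists n.
by rewrite (muE n).1 dP// nd exprn_gt0// invr_gt0.
Qed.

End AdditiveSquares.

Section DirectionalCalculus.
Context {R : realType}.
Implicit Types (f g : R[i] -> R[i]) (z w l v : R[i]).

Lemma has_cderiv_continuous f z l : has_cderiv f z l -> continuous_pt f z.
Proof.
move=> fd e e0; have [d d0 dP] := fd 1 ltr01.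
pose K := cabs l + 1; have K0 : 0 < K by rewrite ltr_wpDl ?cabs_ge0.
exists (Num.min d (e / K)); first by rewrite lt_min d0 divr_gt0.
move=> h; rewrite lt_min ltr_pdivlMr// => /andP[hd he].
have := dP h hd; have := cabsD (f (z + h) - f z - l * h) (l * h).
by rewrite subrK cabsM mul1r; move: he; rewrite /K mulrDr; lra.
Qed.

Lemma has_cderiv_dir f z l v : has_cderiv f z l -> has_dderiv f z v (l * v).
Proof.
move=> fd e e0; pose K := cabs v + 1.
have K0 : 0 < K by rewrite ltr_wpDl ?cabs_ge0.
have vK x : cabs (x%:C%C * v) <= `|x| * K.
  by rewrite cabsM cabs_real ler_wpM2l// lerDl.
have [d d0 dP] := fd (e / K) (divr_gt0 e0 K0).
exists (d / K); first by rewrite divr_gt0.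
move=> x; rewrite ltr_pdivlMr// -mulrA (mulrC v) => xd.
rewrite (le_trans (dP _ (le_lt_trans (vK _) xd)))//.
rewrite (le_trans (ler_wpM2l _ (vK _))) ?(ltW (divr_gt0 e0 K0))//.
by rewrite mulrCA divfK ?gt_eqF// mulrC.
Qed.

Lemma has_dderiv_scale f z v l (k : R) :
  has_dderiv f z v l -> has_dderiv f z (k%:C%C * v) (l * k%:C%C).
Proof.
move=> fd e e0; pose K := `|k| + 1.
have K0 : 0 < K by rewrite ltr_wpDl.
have kK (x : R) : `|x * k| <= `|x| * K by rewrite normrM ler_wpM2l// lerDl.
have [d d0 dP] := fd (e / K) (divr_gt0 e0 K0).
exists (d / K); first by rewrite divr_gt0.
move=> x; rewrite ltr_pdivlMr// => xd.
rewrite [x%:C%C * _]mulrA -[l * _ * _]mulrA (mulrC k%:C%C) -rmorphM /=.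
rewrite (le_trans (dP _ (le_lt_trans (kK _) xd)))//.
rewrite (le_trans (ler_wpM2l _ (kK _))) ?(ltW (divr_gt0 e0 K0))//.
by rewrite mulrCA divfK ?gt_eqF// mulrC.
Qed.

Lemma has_dderivB f g z v l w : has_dderiv f z v l -> has_dderiv g z v w ->
  has_dderiv (fun u => f u - g u) z v (l - w).
Proof.
move=> fd gd e e0; have e2 : 0 < e / 2 by rewrite divr_gt0.
have [d1 d10 fP] := fd _ e2; have [d2 d20 gP] := gd _ e2.
exists (Num.min d1 d2); first by rewrite lt_min d10.
move=> x; rewrite lt_min => /andP[x1 x2].
have -> : f (z + x%:C%C * v) - g (z + x%:C%C * v) - (f z - g z) - (l - w) * x%:C%C
  = (f (z + x%:C%C * v) - f z - l * x%:C%C) - (g (z + x%:C%C * v) - g z - w * x%:C%C).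
  by ring.
rewrite (le_trans (cabsD _ _))// cabsN.
by rewrite [leRHS](_ : _ = e / 2 * `|x| + e / 2 * `|x|) ?lerD ?fP ?gP//; field.
Qed.

(** A primitive of the affine function w |-> q + l (w - c). *)
Definition affine_primitive (q l c w : R[i]) := q * w + l * (w - c) ^+ 2 / 2.

Lemma has_cderiv_affine_primitive q l c w :
  has_cderiv (affine_primitive q l c) w (q + l * (w - c)).
Proof.
move=> e e0; pose K := cabs l + 1.
have K0 : 0 < K by rewrite ltr_wpDl ?cabs_ge0.
exists (e / K) => [|h]; first by rewrite divr_gt0.
rewrite ltr_pdivlMr// => he.
have -> : affine_primitive q l c (w + h) - affine_primitive q l c w
    - (q + l * (w - c)) * h = l / 2 * h * h by rewrite /affine_primitive; field.
rewrite cabsM ler_wpM2r ?cabs_ge0// !cabsM.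
have -> : cabs (2^-1 : R[i]) = 2^-1.
  by rewrite cabsV -(rmorph_nat (@real_complex_def R (Phant R))) cabs_real ger0_norm.
move: he; rewrite /K mulrDr mulr1; have := cabs_ge0 h; have := cabs_ge0 l.
by have := mulr_ge0 (cabs_ge0 l) (cabs_ge0 h); lra.
Qed.

(** Replacing f by an affine approximation that is M-close on a segment changes
    the increment of a primitive by at most M times the length. Only derivatives
    of A along the segment enter, so the lemma serves antiderivatives in one
    direction as well as genuine primitives. *)
Lemma primitive_increment (A : R[i] -> R[i]) f z v q l c (k M : R) :
  cabs v = 1 ->
  (forall x : R, 0 <= x <= 1 ->
     has_dderiv A (z + x%:C%C * (k%:C%C * v)) v (f (z + x%:C%C * (k%:C%C * v)) * v)) ->
  (forall x : R, 0 <= x <= 1 -> let w := z + x%:C%C * (k%:C%C * v) in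
     cabs (f w - (q + l * (w - c))) <= M) ->
  cabs (A (z + k%:C%C * v) - A z
    - (affine_primitive q l c (z + k%:C%C * v) - affine_primitive q l c z)) <= M * `|k|.
Proof.
move=> v1 Ad fM; set P := affine_primitive q l c.
have := @mean_value_le R (fun w => A w - P w) z (k%:C%C * v)
  (fun x => (f (z + x%:C%C * (k%:C%C * v)) * v
     - (q + l * (z + x%:C%C * (k%:C%C * v) - c)) * v) * k%:C%C) 0 (M * `|k|).
rewrite subr0 [X in cabs X <= _](_ : _ = A (z + k%:C%C * v) - A z - (P (z + k%:C%C * v) - P z)); last by ring.
apply=> x x01.
  apply: has_dderiv_scale; apply: has_dderivB; first exact: Ad.
  by apply: has_cderiv_dir; exact: has_cderiv_affine_primitive.
rewrite subr0 -mulrBl !cabsM v1 mulr1 cabs_real ler_wpM2r//; exact: fM.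
Qed.

End DirectionalCalculus.

(** * Integrals over boundaries of rectangles *)

Section RectangleIntegral.
Context {R : realType}.
Variables (f A B : R[i] -> R[i]) (r : R).
Hypothesis A_prim : forall z, cabs z < r -> has_dderiv A z 1 (f z * 1).
Hypothesis B_prim : forall z, cabs z < r -> has_dderiv B z 'i%C (f z * 'i%C).

Section Sides.
Variables (p : R[i]) (l m : R).

(** The rectangle with corner p and signed sides l and i m is parametrised by the
    unit square; signed sides make all positions of the opposite corner alike. *)
Definition rect_pt (s t : R) : R[i] := p + (s * l)%:C%C + (t * m)%:C%C * 'i%C.

(** The integral of f over the boundary of the parameter square
    [s, s + e] x [t, t + e], each side contributing an increment of A or of B. *)
Definition rect_integral (s t e : R) : R[i] :=
  (A (rect_pt (s + e) t) - A (rect_pt s t))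
  + (B (rect_pt (s + e) (t + e)) - B (rect_pt (s + e) t))
  - (A (rect_pt (s + e) (t + e)) - A (rect_pt s (t + e)))
  - (B (rect_pt s (t + e)) - B (rect_pt s t)).

Lemma rect_integral_additive : square_additive rect_integral.
Proof.
have half (x e : R) : x + e / 2 + e / 2 = x + e by field.
by move=> s t e; rewrite /rect_integral !half; ring.
Qed.

(** The integral of an affine function over a closed path is 0: its primitive P
    is the same for horizontal and vertical sides, and the four increments of P
    cancel. What remains is the deviation of f from it, times the perimeter. *)
Lemma rect_integral_le q c l1 (s t e M : R) : 0 <= e ->
  (forall a b, s <= a <= s + e -> t <= b <= t + e ->
     cabs (rect_pt a b) < r /\
     cabs (f (rect_pt a b) - (q + l1 * (rect_pt a b - c))) <= M) ->
  cabs (rect_integral s t e) <= 2 * M * (`|l| + `|m|) * e.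
Proof.
move=> e0 fM; pose P := affine_primitive q l1 c.
have se (a y : R) : 0 <= y <= 1 -> a <= a + y * e <= a + e.
  by move=> /andP[y0 y1]; rewrite lerDl mulr_ge0//= lerD2l ler_piMl.
have Hh b : t <= b <= t + e ->
  cabs (A (rect_pt (s + e) b) - A (rect_pt s b)
    - (P (rect_pt (s + e) b) - P (rect_pt s b))) <= M * (`|l| * e).
  move=> hb; have E y : rect_pt s b + y%:C%C * ((e * l)%:C%C * 1) = rect_pt (s + y * e) b.
    by rewrite /rect_pt mulr1 -rmorphM /= mulrDl mulrA rmorphD /=; ring.
  have -> : s + e = s + 1 * e by rewrite mul1r.
  rewrite -E rmorph1 mul1r -[in leRHS](ger0_norm e0) -normrM (mulrC l).
  apply: (@primitive_increment _ _ f); first exact: cabs1.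
    by move=> x x01; rewrite E; apply: A_prim; apply: (fM _ _ _ _).1 => //; exact: se.
  by move=> x x01 /=; rewrite E; apply: (fM _ _ _ _).2 => //; exact: se.
have Hv a : s <= a <= s + e ->
  cabs (B (rect_pt a (t + e)) - B (rect_pt a t)
    - (P (rect_pt a (t + e)) - P (rect_pt a t))) <= M * (`|m| * e).
  move=> ha; have E y : rect_pt a t + y%:C%C * ((e * m)%:C%C * 'i%C) = rect_pt a (t + y * e).
    by rewrite /rect_pt mulrA -rmorphM /= (mulrDl t) mulrA (rmorphD _ (t * m)) /=; ring.
  have -> : t + e = t + 1 * e by rewrite mul1r.
  rewrite -E rmorph1 mul1r -[in leRHS](ger0_norm e0) -normrM (mulrC m).
  apply: (@primitive_increment _ _ f); first exact: cabs_i.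
    by move=> x x01; rewrite E; apply: B_prim; apply: (fM _ _ _ _).1 => //; exact: se.
  by move=> x x01 /=; rewrite E; apply: (fM _ _ _ _).2 => //; exact: se.
have tt : t <= t <= t + e by rewrite lexx lerDl.
have te : t <= t + e <= t + e by rewrite lexx lerDl e0.
have ss : s <= s <= s + e by rewrite lexx lerDl.
have s1 : s <= s + e <= s + e by rewrite lexx lerDl e0.
have := Hh _ tt; have := Hh _ te; have := Hv _ ss; have := Hv _ s1.
set v1 := _ - (_ - _); set v0 := _ - (_ - _); set h1 := _ - (_ - _); set h0 := _ - (_ - _).
move=> Hv1 Hv0 Hh1 Hh0.
have -> : rect_integral s t e = h0 + v1 - h1 - v0.
  by rewrite /rect_integral /h0 /h1 /v0 /v1; ring.
have := cabsD (h0 + v1 - h1) (- v0); have := cabsD (h0 + v1) (- h1); have := cabsD h0 v1.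
rewrite !cabsN; lra.
Qed.

Lemma rect_pt_dist (s t a b e : R) : a <= s <= a + e -> b <= t <= b + e ->
  forall x y, a <= x <= a + e -> b <= y <= b + e ->
  cabs (rect_pt x y - rect_pt s t) <= (`|l| + `|m|) * e.
Proof.
move=> hs ht x y hx hy.
have -> : rect_pt x y - rect_pt s t = ((x - s) * l)%:C%C + ((y - t) * m)%:C%C * 'i%C.
  by rewrite /rect_pt !mulrBl !rmorphB /=; ring.
rewrite (le_trans (cabsD _ _))// cabsM cabs_i mulr1 !cabs_real !normrM mulrDl.
by rewrite !(mulrC _ e) lerD// ler_wpM2r// ler_norml; lra.
Qed.

(** The derivative at the point gives an affine approximation with error
    o(distance), which is o(e) on a square of side e; the perimeter contributes
    a second factor e. *)
Lemma rect_integral_negligible (s t : R) l1 :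
  cabs (rect_pt s t) < r -> has_cderiv f (rect_pt s t) l1 ->
  square_negligible rect_integral s t.
Proof.
move=> zr fd eps eps0; pose L := `|l| + `|m| + 1.
have L0 : 0 < L by rewrite ltr_wpDl// addr_ge0.
have LM : `|l| + `|m| <= L by rewrite lerDl.
have [d d0 dP] := fd (eps / (2 * L ^+ 2)) (divr_gt0 eps0 (mulr_gt0 (ltr0n _ 2) (exprn_gt0 _ L0))).
pose d' := Num.min d (r - cabs (rect_pt s t)).
have d'0 : 0 < d' by rewrite lt_min d0 subr_gt0.
exists (d' / L) => [|a b e]; first by rewrite divr_gt0.
rewrite ltr_pdivlMr// => /andP[e0 eL] hs ht.
have ->  : eps * e ^+ 2 = 2 * (eps / (2 * L ^+ 2) * (L * e)) * L * e.
  by field; rewrite gt_eqF.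
set M := eps / (2 * L ^+ 2) * (L * e).
have Le0 : 0 <= eps / (2 * L ^+ 2) by rewrite ltW// divr_gt0// mulr_gt0// exprn_gt0.
have M0 : 0 <= M by rewrite mulr_ge0// ltW// mulr_gt0.
apply: (@le_trans _ _ (2 * M * (`|l| + `|m|) * e)); last first.
  by rewrite (ler_wpM2r (ltW e0))// ler_wpM2l// mulr_ge0.
apply: (rect_integral_le (f (rect_pt s t)) (rect_pt s t) l1) => [|]; first exact: ltW.
move=> x y hx hy.
set z := rect_pt x y; set z0 := rect_pt s t.
have zL : cabs (z - z0) <= L * e.
  by apply: le_trans (rect_pt_dist _ _ _ _ _ hs ht _ _ hx hy) _; rewrite ler_wpM2r// ltW.
have zd' : cabs (z - z0) < d' by rewrite (le_lt_trans zL)// mulrC.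
move: (zd'); rewrite lt_min => /andP[zd zr'].
split; first by have := cabsD (z - z0) z0; rewrite subrK -/z0 in zr' *; lra.
have := dP _ zd; rewrite [z0 + _]addrC subrK => h; rewrite opprD addrA.
by apply: le_trans h _; rewrite ler_wpM2l.
Qed.

Lemma rect_integral_eq0 :
  (forall s t : R, 0 <= s <= 1 -> 0 <= t <= 1 -> cabs (rect_pt s t) < r) ->
  continuous_pt f p ->
  (forall s t : R, 0 <= s <= 1 -> 0 <= t <= 1 -> 0 < s + t ->
     exists l1, has_cderiv f (rect_pt s t) l1) ->
  rect_integral 0 0 1 = 0.
Proof.
move=> inr fc fd; apply: square_additive_corner_eq0.
- exact: rect_integral_additive.
- move=> s t hs ht st; have [l1 fl] := fd _ _ hs ht st.
  by apply: rect_integral_negligible fl; exact: inr.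
(* Near p the function f is within 1 of the constant f p, whose integral is 0. *)
move=> eps eps0; have [d d0 dP] := fc 1 ltr01.
pose L := `|l| + `|m| + 1.
have L0 : 0 < L by rewrite ltr_wpDl// addr_ge0.
have LM : `|l| + `|m| <= L by rewrite lerDl.
exists (Num.min (Num.min (d / L) (eps / (2 * L))) 1).
  by rewrite !lt_min !divr_gt0// ?mulr_gt0// ltr01.
move=> e; rewrite !lt_min !ltr_pdivlMr ?mulr_gt0// => /andP[e0 /andP[/andP[ed ee] e1]].
apply: (@le_trans _ _ (2 * 1 * (`|l| + `|m|) * e)); last first.
  by have := ler_wpM2r (ltW e0) LM; lra.
apply: (rect_integral_le (f p) 0 0) => [|a b]; first exact: ltW.
rewrite !add0r => ha hb; split; first by apply: inr; lra.
rewrite mul0r addr0; have -> : rect_pt a b = p + (rect_pt a b - p) by ring.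
apply: dP.
have p00 : rect_pt 0 0 = p by rewrite /rect_pt !mul0r !addr0.
rewrite -[X in _ - X]p00; apply: (@le_lt_trans _ _ ((`|l| + `|m|) * e)).
  by apply: (rect_pt_dist _ _ 0 0); rewrite ?add0r ?lexx//= ltW.
by apply: le_lt_trans ed; rewrite mulrC ler_wpM2l// ltW.
Qed.

End Sides.
End RectangleIntegral.

(** * Primitives in a disk *)

Section Primitive.
Context {R : realType}.
Implicit Types (f A : R[i] -> R[i]) (z : R[i]) (r rho : R).

Lemma cabs_lt_ReIm z r : 0 < r -> (cabs z < r) = (complex.Re z ^+ 2 + complex.Im z ^+ 2 < r ^+ 2).
Proof.
by move=> r0; rewrite -cabs_sqr ltr_pXn2r// ?nnegrE ?cabs_ge0// ltW.
Qed.

Lemma segment_antiderivative (u : R -> R) (a b : R) :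
  (forall x, a <= x <= b -> {for x, continuous u}) ->
  exists U : R -> R, forall x, a < x < b -> is_derive x 1 U (u x).
Proof.
move=> uc; exists (fun x => \int[lebesgue_measure]_(t in [set` `[a, x]]) u t)%R.
move=> x /andP[ax xb].
have ui : lebesgue_measure.-integrable `[a, b] (EFin \o u).
  apply: continuous_compact_integrable; first exact: segment_compact.
  apply: continuous_in_subspaceT => y; rewrite inE /= in_itv /=; exact: uc.
have ux : {for x, continuous u} by apply: uc; rewrite !ltW.
have [dU eU] := continuous_FTC1_closed xb ui ax ux.
by apply: DeriveDef; [exact: dU|rewrite -derive1E; exact: eU].
Qed.

(** On each horizontal chord of the disk of radius r the two real components are
    integrated from the left end of the chord, which lies inside the larger disk
    where f is continuous. Nothing relates the constants on different chords, so
    A need not be regular in the vertical direction. *)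
Lemma horizontal_antiderivative f r rho : r < rho ->
  (forall z, cabs z < rho -> continuous_pt f z) ->
  exists A, forall z, cabs z < r -> has_dderiv A z 1 (f z * 1).
Proof.
move=> rrho fc; have [r0|r0] := leP r 0.
  by exists f => z zr; have := cabs_ge0 z; lra.
pose pt (x y : R) : R[i] := (x +i* y)%C.
have part (P : R[i] -> R) : (forall z w, P (z - w) = P z - P w) ->
    (forall z, `|P z| <= cabs z) ->
    exists U : R -> R -> R, forall x y, cabs (pt x y) < r ->
    is_derive x 1 (U y) (P (f (pt x y))).
  move=> PB Ple.
  suff : forall y, exists U : R -> R, forall x, cabs (pt x y) < r ->
      is_derive x 1 U (P (f (pt x y))) by move=> /choice[U UP]; exists U => x y; exact: UP.
  move=> y; have [ry|ry] := leP (r ^+ 2) (y ^+ 2).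
    by exists (fun=> 0) => x; rewrite (cabs_lt_ReIm _ _ r0) /=; have := sqr_ge0 x; lra.
  pose b := Num.sqrt (r ^+ 2 - y ^+ 2).
  have b2 : b ^+ 2 = r ^+ 2 - y ^+ 2 by rewrite sqr_sqrtr//; lra.
  have [|U UP] := @segment_antiderivative (fun x => P (f (pt x y))) (- b) b; last first.
    exists U => x; rewrite (cabs_lt_ReIm _ _ r0) /= => xy; apply: UP.
    by rewrite -ltr_norml -sqrtr_sqr ltr_sqrt; lra.
  move=> x; rewrite -ler_norml => xb; apply/cvgrPdist_le => e e0.
  have ptrho : cabs (pt x y) < rho.
    apply: le_lt_trans rrho; rewrite -(@ler_pXn2r _ 2) ?nnegrE ?cabs_ge0 ?(ltW r0)//.
    rewrite cabs_sqr /=.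
    have : `|x| ^+ 2 <= b ^+ 2 by rewrite ler_pXn2r// nnegrE sqrtr_ge0.
    by rewrite real_normK ?num_real// b2; lra.
  have [d d0 dP] := fc _ ptrho e e0.
  near=> h; rewrite -PB (le_trans (Ple _))// cabsB.
  have -> : pt h y = pt x y + (h - x)%:C%C.
    by rewrite /pt; apply/eqP; rewrite eq_complex /= addr0 addrC subrK !eqxx.
  apply: dP; rewrite cabs_real distrC; near: h.
  exact: (@cvgr_dist_lt _ _ _ (nbhs x) _ id x (@cvg_id _ _)).
have [U1 U1P] := part (@complex.Re R) (@ReB R) (@Re_le_cabs R).
have [U2 U2P] := part (@complex.Im R) (@ImB R) (@Im_le_cabs R).
exists (fun z => pt (U1 (complex.Im z) (complex.Re z)) (U2 (complex.Im z) (complex.Re z))).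
case=> x y zr e e0; rewrite !mulr1 /=.
have e2 : 0 < e / 2 by rewrite divr_gt0.
have [d1 d10 P1] := (is_derive_eps _ _ _).2 (U1P x y zr) _ e2.
have [d2 d20 P2] := (is_derive_eps _ _ _).2 (U2P x y zr) _ e2.
exists (Num.min d1 d2) => [|h]; first by rewrite lt_min d10.
rewrite lt_min => /andP[h1 h2]; rewrite (le_trans (cabs_le_ReIm _))//.
have := P1 h h1; have := P2 h h2; rewrite /pt mulr1 /= addr0.
case: (f _) => a b /=; rewrite !(mulr0, mulr1, addr0, subr0, oppr0, add0r).
lra.
Unshelve. all: by end_near. Qed.

(** If A is a horizontal antiderivative of f(i w), then i A(- i z) is a vertical
    one of f. *)
Lemma vertical_antiderivative f r rho : r < rho ->
  (forall z, cabs z < rho -> continuous_pt f z) ->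
  exists B, forall z, cabs z < r -> has_dderiv B z 'i%C (f z * 'i%C).
Proof.
move=> rrho fc.
have ciz z : cabs ('i%C * z) = cabs z by rewrite cabsM cabs_i mul1r.
have [z zr e e0|A AP] := @horizontal_antiderivative (fun z => f ('i%C * z)) r rho rrho.
  have izr : cabs ('i%C * z) < rho by rewrite ciz.
  have [d d0 dP] := fc _ izr e e0; exists d => // h hd.
  by rewrite mulrDr; apply: dP; rewrite ciz.
exists (fun z => 'i%C * A (- 'i%C * z)) => z zr e e0.
have izr : cabs (- 'i%C * z) < r by rewrite mulNr cabsN ciz.
have [d d0 dP] := AP _ izr e e0; exists d => // h hd.
have := dP h hd; rewrite !mulr1 mulrA mulrN mul_ii opprK mul1r.
have -> : - 'i%C * (z + h%:C%C * 'i%C) = - 'i%C * z + h%:C%C.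
  by rewrite mulrDr [- 'i%C * (h%:C%C * _)]mulrCA !mulNr mul_ii opprK mulr1.
apply: le_trans; rewrite -[leRHS]ciz le_eqVlt; apply/orP; left; apply/eqP.
by congr cabs; ring.
Qed.

(** Integrate f from 0 to z along the two sides through the corner Re z. By the
    vanishing of rectangle integrals, the path through the corner i Im z gives
    the same value. The last leg is vertical on the first path and horizontal on
    the second, so the increments of G in both directions are integrals of f,
    and continuity of f makes G complex differentiable.
    A rectangle with corners 0 and z that is not degenerate meets the exceptional
    point 0 only in a corner. *)
Lemma punctured_primitive f r rho : r < rho ->
  (forall z, cabs z < rho -> continuous_pt f z) ->
  (forall z, cabs z < rho -> z != 0 -> exists l, has_cderiv f z l) ->
  exists G, forall z, cabs z < r -> has_cderiv G z (f z).
Proof.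
move=> rrho fc fd.
have [A AP] := horizontal_antiderivative f r rho rrho fc.
have [B BP] := vertical_antiderivative f r rho rrho fc.
pose re z : R[i] := (complex.Re z)%:C%C; pose im z : R[i] := 'i%C * (complex.Im z)%:C%C.
pose G z := A (re z) - A 0 + (B z - B (re z)).
have sub z x y : cabs z < r -> 0 <= x <= 1 -> 0 <= y <= 1 ->
    cabs (rect_pt 0 (complex.Re z) (complex.Im z) x y) < r.
  move=> zr /andP[x0 x1] /andP[y0 y1]; apply: le_lt_trans zr.
  rewrite -(@ler_pXn2r _ 2) ?nnegrE ?cabs_ge0//.
  rewrite !cabs_sqr /= !(mulr0, mulr1, mul0r, addr0, subr0, oppr0, add0r) !exprMn.
  by rewrite lerD// ler_piMl ?sqr_ge0// expr_le1.
have GE z : cabs z < r -> G z = B (im z) - B 0 + (A z - A (im z)).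
  move=> zr; apply/eqP; rewrite -subr_eq0; apply/eqP.
  have zE : z = re z + im z by rewrite /re /im -complexE.
  have [x0|x0] := eqVneq (complex.Re z) 0.
    have rz : re z = 0 by rewrite /re x0.
    have iz : im z = z by rewrite {2}zE rz add0r.
    by rewrite /G rz iz; ring.
  have [y0|y0] := eqVneq (complex.Im z) 0.
    have iz : im z = 0 by rewrite /im y0 rmorph0 mulr0.
    have rz : re z = z by rewrite {2}zE iz addr0.
    by rewrite /G rz iz; ring.
  have := @rect_integral_eq0 _ f A B r AP BP 0 (complex.Re z) (complex.Im z).
  rewrite /rect_integral /rect_pt !(mul0r, mul1r, add0r, addr0).
  rewrite (mulrC _ 'i%C) -/(re z) -/(im z) -zE => key; rewrite -[RHS]key; first by rewrite /G; ring.
  - by move=> s t hs ht; have := sub z s t zr hs ht; rewrite /rect_pt add0r.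
  - by apply: fc; rewrite cabs0; have := cabs_ge0 z; lra.
  move=> s t hs ht st; apply: fd.
    by have := sub z s t zr hs ht; rewrite /rect_pt add0r => /lt_trans; apply.
  rewrite eq_complex /= !(mulr0, mulr1, mul0r, addr0, subr0, oppr0, add0r).
  by rewrite !mulf_eq0 (negbTE x0) (negbTE y0) !orbF; apply/negP => /andP[/eqP s0 /eqP t0]; lra.
exists G => z zr e e0; have e2 : 0 < e / 2 by rewrite divr_gt0.
have [d d0 dP] := fc z (lt_trans zr rrho) _ e2.
exists (Num.min d (r - cabs z)) => [|h]; first by rewrite lt_min d0 subr_gt0.
rewrite lt_min => /andP[hd hr].
pose z1 := z + im h.
have hE : h = re h + im h by rewrite /re /im -complexE.
have imh : cabs (im h) <= cabs h by rewrite cabsM cabs_i mul1r cabs_real Im_le_cabs.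
have reh : cabs (re h) <= cabs h by rewrite cabs_real Re_le_cabs.
have near_z k : cabs k <= cabs h -> cabs (z + k) < r.
  by have := cabsD z k; lra.
have Gh : G (z + h) - G z1 = A (z1 + re h * 1) - A z1.
  rewrite !GE; [|exact: near_z..].
  have -> : im (z + h) = im z1 by rewrite /z1 /im !ImD /= !(mul0r, mulr0, mul1r, add0r, addr0, subr0).
  have -> : z + h = z1 + re h by rewrite {1}hE /z1; ring.
  by rewrite mulr1; ring.
have Gv : G z1 - G z = B (z + im h) - B z.
  have -> : G z1 = A (re z) - A 0 + (B z1 - B (re z)).
    rewrite /G; have -> // : re z1 = re z.
    by rewrite /re /z1 /im ReD /= !(mul0r, mulr0, mul1r, add0r, addr0, subr0).
  by rewrite /G /z1; ring.
have on_h x : 0 <= x <= 1 -> cabs (im h + x%:C%C * (re h * 1)) <= cabs h.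
  move=> /andP[x0 x1]; rewrite -(@ler_pXn2r _ 2) ?nnegrE ?cabs_ge0//.
  rewrite !cabs_sqr /= !(mulr0, mulr1, mul0r, mul1r, addr0, subr0, oppr0, add0r) !exprMn.
  by rewrite lerD// ler_piMl ?sqr_ge0// expr_le1.
have on_v x : 0 <= x <= 1 -> cabs (x%:C%C * im h) <= cabs h.
  move=> /andP[x0 x1]; rewrite cabsM cabs_real (le_trans _ imh)// ler_piMl ?cabs_ge0//.
  by rewrite ger0_norm.
have fz k : cabs k <= cabs h -> cabs (f (z + k) - f z) <= e / 2.
  by move=> kh; apply: dP; lra.
have H1 : cabs (A (z1 + re h * 1) - A z1 - f z * re h) <= e / 2 * cabs h.
  apply: (@mean_value_le _ A z1 _ (fun x => f (z1 + x%:C%C * (re h * 1)) * 1 * re h)) => x x01.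
    by apply: has_dderiv_scale; apply: AP; rewrite -addrA; apply: near_z; exact: on_h.
  rewrite mulr1 -mulrBl cabsM ler_pM ?cabs_ge0// /z1 -addrA; apply: fz; exact: on_h.
have H2 : cabs (B (z + im h) - B z - f z * im h) <= e / 2 * cabs h.
  rewrite /im [in B _]mulrC.
  apply: (@mean_value_le _ B z _ (fun x =>
    f (z + x%:C%C * ((complex.Im h)%:C%C * 'i%C)) * 'i%C * (complex.Im h)%:C%C)) => x x01.
    by apply: has_dderiv_scale; apply: BP; apply: near_z; rewrite (mulrC _ 'i%C); exact: on_v.
  rewrite -mulrA -mulrBl cabsM ler_pM ?cabs_ge0//; apply: fz; rewrite (mulrC _ 'i%C); exact: on_v.
have -> : G (z + h) - G z - f z * h = (A (z1 + re h * 1) - A z1 - f z * re h)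
   + (B (z + im h) - B z - f z * im h).
  by rewrite -Gh -Gv [in f z * h]hE; ring.
by rewrite (le_trans (cabsD _ _))//; lra.
Qed.

End Primitive.

(** * Four-point means and the maximum principle *)

Section MaximumPrinciple.
Context {R : realType}.
Implicit Types (g G q : R[i] -> R[i]) (z w l c : R[i]) (r M : R).

(** Four times the mean over the points z + t u with u^4 = 1. Both u and u^2 sum
    to 0 over these u, so second-order Taylor polynomials at z contribute only
    their constant term. *)
Definition four_sum {V : nmodType} (g : R[i] -> V) z (t : R) : V :=
  g (z + t%:C%C * 1) + g (z + t%:C%C * 'i%C)
  + g (z + t%:C%C * -1) + g (z + t%:C%C * - 'i%C).

Lemma four_sum_le g z (a b : R[i]) (t e : R) :
  (forall u, u \in [:: 1; 'i%C; -1; - 'i%C] ->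
     cabs (g (z + t%:C%C * u) - g z - (a * u + b * (u * u))) <= e) ->
  cabs (four_sum g z t - 4 * g z) <= 4 * e.
Proof.
move=> H.
have H1 := H 1 _; have H2 := H 'i%C _; have H3 := H (-1) _; have H4 := H (- 'i%C) _.
move: H1 H2 H3 H4; rewrite !inE !eqxx !orbT => /(_ isT) H1 /(_ isT) H2 /(_ isT) H3 /(_ isT) H4.
move: H1 H2 H3 H4; rewrite !mulrNN mul_ii /four_sum.
set x1 := _ - _ - _; set x2 := _ - _ - _; set x3 := _ - _ - _; set x4 := _ - _ - _ => H1 H2 H3 H4.
rewrite [X in cabs X](_ : _ = x1 + x2 + x3 + x4); last first.
  by rewrite /x1 /x2 /x3 /x4; ring.
have := cabsD (x1 + x2 + x3) x4; have := cabsD (x1 + x2) x3; have := cabsD x1 x2.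
lra.
Qed.

Lemma cabs_fourth_root (u : R[i]) : u \in [:: 1; 'i%C; -1; - 'i%C] -> cabs u = 1.
Proof.
by rewrite !inE => /or4P[]/eqP ->; rewrite ?cabsN ?cabs1 ?cabs_i.
Qed.

Lemma four_sum_cderiv g z l : has_cderiv g z l ->
  forall e : R, 0 < e -> exists2 d : R, 0 < d & forall t, 0 < t < d ->
    cabs (four_sum g z t - 4 * g z) <= e * t.
Proof.
move=> gl e e0; have e4 : 0 < e / 4 by rewrite divr_gt0.
have [d d0 dP] := gl _ e4; exists d => // t /andP[t0 td].
rewrite [leRHS](_ : _ = 4 * (e / 4 * t)); last by field.
apply: (@four_sum_le g z (l * t%:C%C) 0) => u /cabs_fourth_root u1.
have tu : cabs (t%:C%C * u) = t by rewrite cabsM u1 mulr1 cabs_real gtr0_norm.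
by have := dP (t%:C%C * u); rewrite tu mulrA mul0r addr0; apply.
Qed.

(** By [primitive_increment], the affine approximation of g at z gives a
    second-order Taylor expansion of G at z with error o(t^2), although the
    derivative of g is not known to exist away from z. *)
Lemma four_sum_primitive G g z l (rho : R) : 0 < rho ->
  (forall w, cabs (w - z) < rho -> has_cderiv G w (g w)) -> has_cderiv g z l ->
  forall e : R, 0 < e -> exists2 d : R, 0 < d & forall t, 0 < t < d ->
    cabs (four_sum G z t - 4 * G z) <= e * t ^+ 2.
Proof.
move=> rho0 GP gl e e0; have e4 : 0 < e / 4 by rewrite divr_gt0.
have [d d0 dP] := gl _ e4; exists (Num.min d rho); first by rewrite lt_min d0.
move=> t; rewrite lt_min => /and3P[t0 td tr].
rewrite [leRHS](_ : _ = 4 * (e / 4 * t * t)); last by field.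
apply: (@four_sum_le G z (g z * t%:C%C) (l * t%:C%C * t%:C%C / 2)) => u /cabs_fourth_root u1.
have tu x : 0 <= x <= 1 -> cabs (x%:C%C * (t%:C%C * u)) <= t.
  move=> /andP[x0 x1]; rewrite !cabsM u1 mulr1 !cabs_real !ger0_norm ?ler_piMl// ltW//.
have := @primitive_increment _ G g z u (g z) l z t (e / 4 * t) u1.
rewrite gtr0_norm// => H.
have -> : g z * t%:C%C * u + l * t%:C%C * t%:C%C / 2 * (u * u) =
  affine_primitive (g z) l z (z + t%:C%C * u) - affine_primitive (g z) l z z.
  by rewrite /affine_primitive; field.
apply: H => x x01.
  apply: has_cderiv_dir; apply: GP; rewrite addrC addKr; apply: le_lt_trans tr; exact: tu.
rewrite /= opprD addrA [z + _ - z]addrC addKr.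
apply: le_trans (dP _ (le_lt_trans (tu _ x01) td)) _.
by rewrite ler_wpM2l ?tu// ltW.
Qed.

(** The disk is compact as a closed subset of a square of R x R. *)
Lemma disk_EVT (phi : R[i] -> R) r : 0 <= r ->
  (forall z, cabs z <= r -> forall e : R, 0 < e -> exists2 d : R, 0 < d &
     forall h, cabs h < d -> `|phi (z + h) - phi z| <= e) ->
  exists2 z1, cabs z1 <= r & forall z, cabs z <= r -> phi z <= phi z1.
Proof.
move=> r0 phi_c.
pose A : set (R * R) := [set p | p.1 ^+ 2 + p.2 ^+ 2 <= r ^+ 2].
have AE (p : R * R) : A p <-> cabs (p.1 +i* p.2)%C <= r.
  rewrite -[cabs _ <= r](@ler_pXn2r _ 2) ?nnegrE ?cabs_ge0// cabs_sqr; exact: iff_refl.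
have cA : compact A.
  apply: (@subclosed_compact _ A (`[- r, r] `*` `[- r, r])).
  - rewrite (_ : A = (fun p : R * R => p.1 * p.1 + p.2 * p.2) @^-1` [set x | x <= r ^+ 2])//.
    apply: closed_comp; last exact: closed_le.
    by move=> p _; apply: cvgD; apply: cvgM; (exact: cvg_fst || exact: cvg_snd).
  - by apply: compact_setX; exact: segment_compact.
  move=> p; rewrite /A /= !in_itv /= -!ler_norml => pr.
  have := sqr_ge0 p.1; have := sqr_ge0 p.2.
  by split; rewrite -(@ler_pXn2r _ 2) ?nnegrE// real_normK ?num_real//; lra.
have A0 : A !=set0 by exists (0, 0); apply/AE; rewrite cabs0.
have [|[x y] xyA xy_max] := @compact_EVT_max _ R (fun p => phi (p.1 +i* p.2)%C) A A0 cA.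
  apply: continuous_in_subspaceT => -[x y]; rewrite inE => /AE /= xyr.
  apply/cvgrPdist_le => e e0; have [d d0 dP] := phi_c (x +i* y)%C xyr e e0.
  near=> p; rewrite distrC.
  have -> : (p.1 +i* p.2)%C = (x +i* y)%C + ((p.1 - x) +i* (p.2 - y))%C.
    by apply/eqP; rewrite eq_complex /= !(addrC _ (_ - _)) !subrK !eqxx.
  apply: dP; rewrite (le_lt_trans (cabs_le_ReIm _))//= (splitr d) ltrD//.
    rewrite distrC; near: p; apply: (@cvgr_dist_lt _ _ _ (nbhs (x, y)) _ fst x) => //.
      exact: cvg_fst.
    by rewrite divr_gt0.
  rewrite distrC; near: p; apply: (@cvgr_dist_lt _ _ _ (nbhs (x, y)) _ snd y) => //.
    exact: cvg_snd.
  by rewrite divr_gt0.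
exists (x +i* y)%C; first by move: xyA; rewrite inE => /AE.
by move=> [a b] zr; apply: (xy_max (a, b)); rewrite inE; apply/AE.
Unshelve. all: by end_near. Qed.

Lemma Re_mul4 z w : complex.Re (z * (4 * w)) = 4 * complex.Re (z * w).
Proof. by case: z w => [a b] [x y] /=; ring. Qed.

Lemma four_sum_Re c g z (t : R) :
  complex.Re (c * four_sum g z t) = four_sum (fun w => complex.Re (c * g w)) z t.
Proof. by rewrite /four_sum !mulrDr !ReD. Qed.

Lemma four_sum_sqr z (t : R) :
  four_sum (fun w => cabs w ^+ 2) z t = 4 * cabs z ^+ 2 + 4 * t ^+ 2.
Proof. by rewrite /four_sum /= !cabs_sqr; case: z => a b /=; ring. Qed.

Lemma four_sum_dist c z (t : R) :
  4 * cabs (z - c) <= four_sum (fun w => cabs (w - c)) z t.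
Proof.
have H u : 2 * cabs (z - c) <= cabs (z + t%:C%C * u - c) + cabs (z + t%:C%C * - u - c).
  apply: le_trans (cabsD _ _).
  rewrite -(ger0_norm (ler0n R 2)) -cabs_real -cabsM rmorph_nat.
  by rewrite le_eqVlt; apply/orP; left; apply/eqP; congr cabs; ring.
by have := H 1; have := H 'i%C; rewrite /four_sum; lra.
Qed.

Lemma four_sum_dist0 c (t : R) : 0 < t -> four_sum (fun w => cabs (w - c)) c t = 4 * t.
Proof.
move=> t0; have H u : cabs (c + t%:C%C * u - c) = t * cabs u.
  by rewrite addrC addKr cabsM cabs_real gtr0_norm.
by rewrite /four_sum !H !cabsN cabs1 cabs_i; ring.
Qed.

(** If |q(z0)| > M, take c = conj q(z0), so that Re(c q) at z0 exceeds its values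
    on the circle. The perturbation eps * bar is small enough to keep it so, and
    the maximum of phi is attained at an interior point z1. The four-point mean
    of bar exceeds bar z1 by at least t^2, and by at least t if z1 is one of the
    exceptional points; this beats the deviation allowed for q. *)
Lemma maximum_principle q r M e1 e2 : 0 < r ->
  (forall z, cabs z <= r -> continuous_pt q z) ->
  (forall z, cabs z = r -> cabs (q z) <= M) ->
  (forall z, cabs z < r -> z != e1 -> z != e2 ->
     forall e : R, 0 < e -> exists2 d : R, 0 < d & forall t, 0 < t < d ->
       cabs (four_sum q z t - 4 * q z) <= e * t ^+ 2) ->
  (forall z, cabs z < r -> z = e1 \/ z = e2 ->
     forall e : R, 0 < e -> exists2 d : R, 0 < d & forall t, 0 < t < d ->
       cabs (four_sum q z t - 4 * q z) <= e * t) ->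
  forall z, cabs z <= r -> cabs (q z) <= M.
Proof.
move=> r0 qc qM q4 qe z0 z0r; rewrite leNgt; apply/negP => Mz0.
pose c := conjc (q z0); have cE : cabs c = cabs (q z0) by rewrite cabs_conj.
have M0 : 0 <= M by apply: le_trans (qM r%:C%C _); rewrite ?cabs_ge0// cabs_real gtr0_norm.
have c0 : 0 < cabs c by rewrite cE (le_lt_trans M0).
pose bar w := cabs w ^+ 2 + cabs (w - e1) + cabs (w - e2).
pose D := r ^+ 2 + (r + cabs e1) + (r + cabs e2).
have barD w : cabs w <= r -> bar w <= D.
  move=> wr; have := cabsD w (- e1); have := cabsD w (- e2); rewrite !cabsN.
  have : cabs w ^+ 2 <= r ^+ 2 by rewrite ler_pXn2r// nnegrE ?cabs_ge0// ltW.
  by rewrite /bar /D; lra.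
have bar0 w : 0 <= bar w by rewrite !addr_ge0 ?cabs_ge0// exprn_ge0 ?cabs_ge0.
have D0 : 0 < D.
  have := cabs_ge0 e1; have := cabs_ge0 e2; have : 0 < r ^+ 2 by rewrite exprn_gt0.
  by rewrite /D; lra.
have cM : 0 < cabs c * (cabs c - M) by rewrite mulr_gt0// subr_gt0 cE.
have [eps eps0 epsD] : exists2 eps : R, 0 < eps & eps * D < cabs c * (cabs c - M).
  exists (cabs c * (cabs c - M) / (2 * D)); first by rewrite divr_gt0// mulr_gt0.
  have -> : cabs c * (cabs c - M) / (2 * D) * D = cabs c * (cabs c - M) / 2.
    by field; rewrite gt_eqF.
  by move: cM; lra.
pose phi w := complex.Re (c * q w) + eps * bar w.
have [|z1 z1r z1max] := @disk_EVT phi r (ltW r0).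
  move=> z zr e e0.
  have e'0 : 0 < e / 2 / cabs c by rewrite !divr_gt0.
  have [d d0 dP] := qc z zr _ e'0.
  pose K := 2 * r + 3.
  have K0 : 0 < K by rewrite /K; lra.
  exists (Num.min (Num.min d 1) (e / 2 / (eps * K))).
    by rewrite !lt_min d0 ltr01 !divr_gt0// mulr_gt0.
  move=> h; rewrite !lt_min => /andP[/andP[hd h1]].
  rewrite ltr_pdivlMr ?mulr_gt0// => hK.
  have -> : phi (z + h) - phi z = complex.Re (c * (q (z + h) - q z)) + eps * (bar (z + h) - bar z).
    by rewrite /phi (mulrBr c) ReB; ring.
  rewrite (splitr e) (le_trans (ler_normD _ _))// lerD//.
    rewrite (le_trans (Re_le_cabs _))// cabsM.
    by rewrite mulrC -ler_pdivlMr// dP.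
  rewrite normrM gtr0_norm//; apply: le_trans (ltW hK).
  rewrite [leRHS]mulrCA ler_pM2l//.
  have E w : `|cabs (z + h - w) - cabs (z - w)| <= cabs h.
    by rewrite (le_trans (ler_distc _ _))// [X in cabs X](_ : _ = h)//; ring.
  have S : `|cabs (z + h) ^+ 2 - cabs z ^+ 2| <= cabs h * (2 * r + 1).
    rewrite subr_sqr normrM; have := E 0; rewrite !subr0 => E0.
    apply: ler_pM => //; rewrite ger0_norm ?addr_ge0 ?cabs_ge0//.
    by have := cabsD z h; lra.
  rewrite /bar; have := E e1; have := E e2.
  set a1 := cabs _ - cabs _; set a2 := cabs _ - cabs _ => A1 A2.
  rewrite [X in `|X|](_ : _ = cabs (z + h) ^+ 2 - cabs z ^+ 2 + a2 + a1); last first.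
    by rewrite /a1 /a2; ring.
  rewrite !(le_trans (ler_normD _ _))//.
  have := ler_normD (cabs (z + h) ^+ 2 - cabs z ^+ 2) a2; rewrite /K.
  lra.
have phi0 : cabs c ^+ 2 <= phi z0.
  rewrite /phi conjM_cabs /= cE lerDl mulr_ge0// ltW//.
have z1lt : cabs z1 < r.
  rewrite lt_def z1r andbT; apply/negP => /eqP rz1.
  have : phi z1 <= cabs c * M + eps * D.
    rewrite lerD//; last by rewrite ler_wpM2l ?barD// ltW.
    rewrite (le_trans (ler_norm _))// (le_trans (Re_le_cabs _))// cabsM.
    by rewrite ler_wpM2l ?cabs_ge0// qM.
  have := z1max _ z0r; move: phi0 epsD; rewrite mulrBr expr2; lra.
have phi4 t : 0 < t -> cabs z1 + t <= r -> four_sum phi z1 t <= 4 * phi z1.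
  move=> t0 tr; have H u : cabs u = 1 -> phi (z1 + t%:C%C * u) <= phi z1.
    move=> u1; apply: z1max; apply: le_trans (cabsD _ _) _.
    by rewrite cabsM u1 cabs_real gtr0_norm// mulr1.
  have := H 1 (cabs1); have := H 'i%C cabs_i; have := H (-1); have := H (- 'i%C).
  by rewrite !cabsN cabs1 cabs_i => /(_ erefl) ? /(_ erefl) ? ? ?; rewrite /four_sum; lra.
have phiE t : four_sum phi z1 t = complex.Re (c * four_sum q z1 t) +
    eps * (four_sum (fun w => cabs w ^+ 2) z1 t + four_sum (fun w => cabs (w - e1)) z1 t
           + four_sum (fun w => cabs (w - e2)) z1 t).
  by rewrite four_sum_Re /four_sum /phi /bar; ring.
have Re4 t K : cabs (four_sum q z1 t - 4 * q z1) <= K ->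
    4 * complex.Re (c * q z1) - cabs c * K <= complex.Re (c * four_sum q z1 t).
  move=> hK; have : `|complex.Re (c * (four_sum q z1 t - 4 * q z1))| <= cabs c * K.
    by rewrite (le_trans (Re_le_cabs _))// cabsM ler_wpM2l// cabs_ge0.
  have -> : complex.Re (c * (four_sum q z1 t - 4 * q z1)) =
     complex.Re (c * four_sum q z1 t) - 4 * complex.Re (c * q z1).
    by rewrite mulrBr ReB Re_mul4.
  by rewrite ler_norml; lra.
have eta0 : 0 < eps / cabs c by rewrite divr_gt0.
have etaE x : cabs c * (eps / cabs c * x) = eps * x by field; rewrite gt_eqF.
have fd1 := fun t => four_sum_dist e1 z1 t.
have fd2 := fun t => four_sum_dist e2 z1 t.
have [ez|/norP[ze1 ze2]] := boolP ((z1 == e1) || (z1 == e2)).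
  have ez' : z1 = e1 \/ z1 = e2 by case/orP: ez => /eqP; [left|right].
  have [d d0 dP] := qe _ z1lt ez' _ eta0.
  pose t := Num.min (d / 2) (r - cabs z1).
  have t0 : 0 < t by rewrite lt_min divr_gt0//= subr_gt0.
  have td : t < d by rewrite gt_min ltr_pdivrMr// ltr_pMr// ltr1n.
  have tr : cabs z1 + t <= r by rewrite -lerBrDl ge_min lexx orbT.
  have := phi4 _ t0 tr; rewrite phiE four_sum_sqr.
  have := Re4 t _ (dP t _); rewrite t0 td => /(_ isT); rewrite etaE.
  have : 4 * cabs (z1 - e1) + 4 * cabs (z1 - e2) + 4 * t <=
     four_sum (fun w => cabs (w - e1)) z1 t + four_sum (fun w => cabs (w - e2)) z1 t.
    case: ez' => ez'; have := fd1 t; have := fd2 t; rewrite ez' four_sum_dist0// subrr cabs0; lra.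
  move/(ler_wpM2l (ltW eps0)); have := mulr_gt0 eps0 t0.
  have : 0 <= eps * t ^+ 2 by rewrite mulr_ge0 ?exprn_ge0 ?ltW.
  rewrite /phi /bar; lra.
have [d d0 dP] := q4 _ z1lt ze1 ze2 _ eta0.
pose t := Num.min (d / 2) (r - cabs z1).
have t0 : 0 < t by rewrite lt_min divr_gt0//= subr_gt0.
have td : t < d by rewrite gt_min ltr_pdivrMr// ltr_pMr// ltr1n.
have tr : cabs z1 + t <= r by rewrite -lerBrDl ge_min lexx orbT.
have := phi4 _ t0 tr; rewrite phiE four_sum_sqr.
have := Re4 t _ (dP t _); rewrite t0 td => /(_ isT); rewrite etaE.
have := ler_wpM2l (ltW eps0) (fd1 t); have := ler_wpM2l (ltW eps0) (fd2 t).
have : 0 < eps * t ^+ 2 by rewrite mulr_gt0 ?exprn_gt0.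
rewrite /phi /bar; lra.
Qed.

End MaximumPrinciple.

(** * The Schwarz lemma *)

Section SchwarzLemma.
Context {R : realType}.
Implicit Types (f g G u : R[i] -> R[i]) (z w l m : R[i]).

(** Through this equivalence sums, products and inverses come from the general
    theory of derivatives, and the chain rule from explicit estimates. *)
Lemma derivable_cderivP (f : Cplx R -> Cplx R) (z : Cplx R) :
  derivable f z (1 : Cplx R) <-> exists l, has_cderiv f z l.
Proof.
have posE (d : R[i]) : 0 < d -> d = (complex.Re d)%:C%C /\ 0 < complex.Re d.
  by case: d => a b; rewrite ltcE /= => /andP[/eqP -> ->].
have quotE (l h : Cplx R) : h != 0 -> f (z + h) - f z - l * h =
    - ((l - h^-1 *: (f (h *: (1 : Cplx R) + z) - f z)) * h).
  by move=> h0; rewrite /GRing.scale /= mulr1 (addrC h); field.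
split=> [/cvg_ex[l]|[l fl]].
  move=> /cvgrPdist_le H; exists l => e e0.
  have := H e%:C%C; rewrite ltcR => /(_ e0); rewrite near_withinE => -[d /= d0 Hd].
  have [dE dR] := posE _ d0; exists (complex.Re d) => // h hd.
  have [->|h0] := eqVneq h 0; first by rewrite addr0 mulr0 subrr subr0 cabs0 mulr0.
  rewrite quotE// cabsN cabsM ler_wpM2r ?cabs_ge0//.
  have := Hd h; rewrite /ball_ /= sub0r normrN dE => Hh.
  have hd' : `|h| < (complex.Re d)%:C%C by rewrite -[`|h|]/((cabs h)%:C%C) ltcR.
  by have := Hh hd' h0; rewrite -[`|_|]/((cabs _)%:C%C) lecR.
apply/cvg_ex; exists l; apply/cvgrPdist_le => e e0.
have [eE eR] := posE _ e0; have [d d0 dP] := fl _ eR.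
near=> h; have h0 : h != 0 by near: h; exact: nbhs_dnbhs_neq.
have : `|h| < d%:C%C by near: h; apply: dnbhs0_lt; rewrite ltcR.
rewrite -[`|h|]/((cabs h)%:C%C) ltcR => /dP; rewrite quotE// cabsN cabsM.
rewrite ler_pM2r ?cabs_gt0// => H.
by rewrite eE -[`|_|]/((cabs _)%:C%C) lecR.
Unshelve. all: by end_near. Qed.

Lemma derivable_mul (f g : Cplx R -> Cplx R) (z : Cplx R) :
  derivable f z (1 : Cplx R) -> derivable g z (1 : Cplx R) ->
  derivable (fun w : Cplx R => f w * g w : Cplx R) z (1 : Cplx R).
Proof. move=> df dg; exact: (@derivableM R[i] (Cplx R) f g z 1 df dg). Qed.

Lemma derivable_inv (f : Cplx R -> Cplx R) (z : Cplx R) :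
  f z != 0 -> derivable f z (1 : Cplx R) ->
  derivable (fun w : Cplx R => (f w : R[i])^-1 : Cplx R) z (1 : Cplx R).
Proof. move=> fz df; exact: (@derivableV R[i] (Cplx R) f z 1 fz df). Qed.

Lemma has_cderiv_comp f u z l m : has_cderiv u z m -> has_cderiv f (u z) l ->
  has_cderiv (fun w => f (u w)) z (l * m).
Proof.
move=> um fl e e0.
pose K := cabs m + 1; have K0 : 0 < K by rewrite ltr_wpDl ?cabs_ge0.
pose L := cabs l + 1; have L0 : 0 < L by rewrite ltr_wpDl ?cabs_ge0.
have e1 : 0 < e / 2 / K by rewrite !divr_gt0.
have e2 : 0 < e / 2 / L by rewrite !divr_gt0.
have [d1 d10 P1] := fl _ e1; have [d2 d20 P2] := um _ e2; have [d3 d30 P3] := um _ ltr01.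
exists (Num.min (Num.min d2 d3) (d1 / K)); first by rewrite !lt_min d20 d30 divr_gt0.
move=> h; rewrite !lt_min ltr_pdivlMr// => /andP[/andP[h2 h3] h1].
pose k := u (z + h) - u z.
have kK : cabs k <= cabs h * K.
  have := P3 h h3; have := cabsD (k - m * h) (m * h); rewrite subrK cabsM.
  rewrite -/k /K; lra.
have -> : f (u (z + h)) - f (u z) - l * m * h =
    (f (u z + k) - f (u z) - l * k) + l * (u (z + h) - u z - m * h).
  rewrite (_ : u z + k = u (z + h)); last by rewrite /k; ring.
  by rewrite /k; ring.
rewrite (le_trans (cabsD _ _))// cabsM.
have H1 : cabs (f (u z + k) - f (u z) - l * k) <= e / 2 * cabs h.
  apply: le_trans (P1 _ (le_lt_trans kK h1)) _.
  apply: le_trans (ler_wpM2l (ltW e1) kK) _.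
  by rewrite mulrCA divfK ?gt_eqF// mulrC.
have H2 : cabs l * cabs (u (z + h) - u z - m * h) <= e / 2 * cabs h.
  apply: le_trans (ler_wpM2l (cabs_ge0 l) (P2 _ h2)) _.
  rewrite mulrA ler_wpM2r ?cabs_ge0// mulrCA ger_pMr ?divr_gt0//.
  by rewrite ler_pdivrMr// mul1r lerDl.
lra.
Qed.

Lemma has_cderiv_quotient G z (h : R) l m : 0 < h ->
  has_cderiv G z l -> has_cderiv G (z + h%:C%C) m ->
  has_cderiv (fun w => (G (w + h%:C%C) - G w) / h%:C%C) z ((m - l) / h%:C%C).
Proof.
move=> h0 Gl Gm e e0; have e2 : 0 < e * h / 2 by rewrite divr_gt0// mulr_gt0.
have [d1 d10 P1] := Gl _ e2; have [d2 d20 P2] := Gm _ e2.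
exists (Num.min d1 d2) => [|k]; first by rewrite lt_min d10.
rewrite lt_min => /andP[k1 k2]; have := P1 k k1; have := P2 k k2.
rewrite (addrAC z).
set x2 := _ - _ - _; set x1 := _ - _ - _ => H2 H1.
have hC : h%:C%C != 0 by rewrite -cabs_gt0 cabs_real normr_gt0 gt_eqF.
rewrite [X in cabs X](_ : _ = (x2 - x1) / h%:C%C); last first.
  by rewrite /x1 /x2; field.
rewrite cabsM cabsV cabs_real gtr0_norm// ler_pdivrMr//.
by have := cabsD x2 (- x1); rewrite cabsN; lra.
Qed.

(** With g(z) = f(z)/z, the maximum principle for the difference quotient q of a
    primitive of g bounds |q(z0)| by the supremum of |g| near the unit circle,
    and q(z0) is close to g(z0). *)
Lemma Schwarz_lemma f :
  (forall z, cabs z < 1 -> exists l, has_cderiv f z l) ->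
  (forall z, cabs z < 1 -> cabs (f z) <= 1) -> f 0 = 0 ->
  forall z, cabs z < 1 -> cabs (f z) <= cabs z.
Proof.
move=> fd f1 f0 z0 z0lt; have [->|z0N0] := eqVneq z0 0; first by rewrite f0.
have [l0 fl0] : exists l, has_cderiv f 0 l by apply: fd; rewrite cabs0.
pose g z := if z == 0 then l0 else f z / z.
have gd z : cabs z < 1 -> z != 0 -> exists l, has_cderiv g z l.
  move=> z1 zN0; have [l] : exists l, has_cderiv (fun w => f w / w) z l.
    apply/derivable_cderivP.
    have df : derivable (f : Cplx R -> Cplx R) z (1 : Cplx R) by apply/derivable_cderivP; exact: fd.
    apply: derivable_mul df _; apply: derivable_inv zN0 _; exact: derivable_id.
  move=> fl; exists l => e e0; have [d d0 dP] := fl e e0.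
  exists (Num.min d (cabs z)) => [|h]; first by rewrite lt_min d0 cabs_gt0.
  rewrite lt_min => /andP[hd hz]; rewrite /g (negbTE zN0) ifN; first exact: dP.
  by apply/eqP => zh; move: hz; rewrite -[h](addKr z) zh addr0 cabsN ltxx.
have gc z : cabs z < 1 -> continuous_pt g z.
  move=> z1; have [->|zN0] := eqVneq z 0; last by have [l /has_cderiv_continuous] := gd z z1 zN0.
  move=> e e0; have [d d0 dP] := fl0 e e0; exists d => // h hd.
  rewrite /g eqxx add0r; have [_|hN0] := eqVneq h 0; first by rewrite subrr cabs0 ltW.
  rewrite -(ler_pM2r (_ : 0 < cabs h)) ?cabs_gt0// -cabsM mulrBl divfK//.
  by have := dP h hd; rewrite add0r f0 subr0.
have g_le z s : 0 < s -> s <= cabs z -> cabs z < 1 -> cabs (g z) <= s^-1.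
  move=> s0 sz z1; rewrite /g ifN; last by rewrite -cabs_gt0 (lt_le_trans s0).
  rewrite cabsM cabsV -[leRHS]mul1r ler_pM ?cabs_ge0 ?invr_ge0 ?cabs_ge0 ?f1//.
  by rewrite lef_pV2// posrE (lt_le_trans s0).
suff : cabs (g z0) <= 1.
  by rewrite /g (negbTE z0N0) cabsM cabsV ler_pdivrMr ?cabs_gt0// mul1r.
rewrite leNgt; apply/negP; set X := cabs (g z0) => X1.
(* G lives in the disk of radius 1 - k, and |g| <= 1/(r - h) <= 1/(1 - 2k) on
   the segments used at radius r = 1 - k - 2h. With
   eps = (X - 1)/4, the first bound on k makes (1 - 2k)(X - eps) > 1; the second
   keeps z0 inside. *)
pose k := Num.min ((X - 1) / (4 * X)) ((1 - cabs z0) / 3).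
have X0 : 0 < X by lra.
have k0 : 0 < k by rewrite lt_min !divr_gt0 ?mulr_gt0//; lra.
have kX : k * (4 * X) <= X - 1 by rewrite -ler_pdivlMr ?mulr_gt0// ge_min lexx.
have kz : k * 3 <= 1 - cabs z0 by rewrite -ler_pdivlMr// ge_min lexx orbT.
clearbody k.
have [G GP] := @punctured_primitive R g (1 - k) 1 ltac:(lra) gc gd.
have z0k : cabs z0 < 1 - k by lra.
have eps0 : 0 < (X - 1) / 4 by lra.
have [d d0 dP] := GP _ z0k _ eps0.
pose h := Num.min (k / 3) (d / 2).
have h0 : 0 < h by rewrite lt_min !divr_gt0.
have hk : 3 * h <= k by rewrite mulrC -ler_pdivlMr// ge_min lexx.
have hd : h < d by rewrite gt_min [d / 2 < d]ltr_pdivrMr// ltr_pMr// ltr1n orbT.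
clearbody h.
have hC : h%:C%C != 0 by rewrite -cabs_gt0 cabs_real normr_gt0 gt_eqF.
have cabsh : cabs h%:C%C = h by rewrite cabs_real gtr0_norm.
pose q z := (G (z + h%:C%C) - G z) / h%:C%C.
pose r := 1 - k - 2 * h.
have r0 : 0 < r by rewrite /r; have := cabs_ge0 z0; lra.
have in_disk z : cabs z <= r -> cabs z < 1 - k /\ cabs (z + h%:C%C) < 1 - k.
  by have := cabsD z h%:C%C; rewrite cabsh /r => ? ?; split; lra.
have qd z : cabs z <= r -> exists l, has_cderiv q z l.
  move=> /in_disk[zr zhr]; exists ((g (z + h%:C%C) - g z) / h%:C%C).
  by apply: has_cderiv_quotient => //; exact: GP.
have G4 z : cabs z < 1 - k -> z != 0 -> forall e : R, 0 < e -> exists2 d : R, 0 < d &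
    forall t, 0 < t < d -> cabs (four_sum G z t - 4 * G z) <= e * t ^+ 2.
  move=> zk zN0; have [|l gl] := gd z _ zN0; first by lra.
  apply: (@four_sum_primitive _ G g z l (1 - k - cabs z)) => //; first lra.
  by move=> w wz; apply: GP; have := cabsD (w - z) z; rewrite subrK; lra.
have xh (x : R) : 0 <= x <= 1 -> cabs (x%:C%C * h%:C%C) <= h.
  move=> /andP[x0 x1]; rewrite cabsM cabsh cabs_real ger0_norm// ler_piMl// ltW//.
have rh0 : 0 < r - h by rewrite /r; have := cabs_ge0 z0; lra.
have : cabs (q z0) <= (r - h)^-1.
  apply: (@maximum_principle _ q r (r - h)^-1 0 (- h%:C%C)) => //.
  - by move=> z /qd[l]; exact: has_cderiv_continuous.
  - move=> z zr; rewrite /q cabsM cabsV cabsh ler_pdivrMr//.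
    rewrite -[G _ - _]subr0.
    apply: (@mean_value_le _ G z h%:C%C (fun x => g (z + x%:C%C * h%:C%C) * h%:C%C)) => x x01.
      apply: has_cderiv_dir; apply: GP.
      by have := cabsD z (x%:C%C * h%:C%C); have := xh x x01; rewrite zr /r; lra.
    have {}xh := xh x x01.
    rewrite subr0 cabsM cabsh ler_wpM2r ?(ltW h0)//; apply: g_le => //.
      have := cabsD (z + x%:C%C * h%:C%C) (- (x%:C%C * h%:C%C)).
      by rewrite addrK cabsN zr; lra.
    by have := cabsD z (x%:C%C * h%:C%C); rewrite zr /r; lra.
  - move=> z zr zN0 zNh e e0; have [zk zhk] := in_disk z (ltW zr).
    have zhN0 : z + h%:C%C != 0 by rewrite addr_eq0.
    have e2 : 0 < e * h / 2 by rewrite divr_gt0// mulr_gt0.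
    have [d1 d10 P1] := G4 _ zk zN0 _ e2; have [d2 d20 P2] := G4 _ zhk zhN0 _ e2.
    exists (Num.min d1 d2) => [|t]; first by rewrite lt_min d10.
    rewrite lt_min => /and3P[t0 t1 t2].
    have := P1 t; have := P2 t; rewrite t0 t1 t2 => /(_ isT) H2 /(_ isT) H1.
    rewrite [X in cabs X](_ : _ = ((four_sum G (z + h%:C%C) t - 4 * G (z + h%:C%C))
      - (four_sum G z t - 4 * G z)) / h%:C%C); last first.
      by rewrite /four_sum /q !(addrAC z h%:C%C); field.
    rewrite cabsM cabsV cabsh ler_pdivrMr//.
    have := cabsD (four_sum G (z + h%:C%C) t - 4 * G (z + h%:C%C)) (- (four_sum G z t - 4 * G z)).
    by rewrite cabsN; lra.
  - move=> z zr _; have [l ql] := qd z (ltW zr); exact: four_sum_cderiv ql.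
  by rewrite /r; lra.
have := dP h%:C%C; rewrite cabsh => /(_ hd).
have -> : G (z0 + h%:C%C) - G z0 - g z0 * h%:C%C = (q z0 - g z0) * h%:C%C.
  by rewrite /q; field.
rewrite cabsM cabsh ler_pM2r// => H1 H2.
have H3 : X <= (r - h)^-1 + (X - 1) / 4.
  have := cabsD (q z0) (g z0 - q z0); rewrite addrCA subrr addr0 -/X => H4.
  by move: H1; rewrite cabsB; lra.
have H5 : (r - h) * (X - (X - 1) / 4) <= 1.
  by rewrite mulrC -ler_pdivlMr// mul1r; lra.
have : (1 - 2 * k) * (X - (X - 1) / 4) <= 1.
  by apply: le_trans H5; apply: ler_wpM2r; rewrite ?/r; lra.
have : 0 < k * (X - 1) by rewrite mulr_gt0// subr_gt0.
move: kX; lra.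
Qed.

End SchwarzLemma.

(** * The Schwarz-Pick lemma and hyperbolic diameters *)

Section SchwarzPick.
Context {R : realType}.
Implicit Types (z w a u : R[i]).

(** The automorphism of the disk that exchanges a and 0 up to sign; its modulus
    is the pseudo-hyperbolic distance to a. *)
Definition moebius a u : R[i] := (u - a) / (1 - conjc a * u).

Lemma moebius_denom a u : cabs a < 1 -> cabs u < 1 -> 1 - conjc a * u != 0.
Proof.
move=> a1 u1; rewrite subr_eq0; apply/eqP => /(congr1 cabs).
rewrite cabs1 cabsM cabs_conj => au.
have := mulr_ilt1 (cabs_ge0 a) (cabs_ge0 u) a1 u1.
by rewrite -au ltxx.
Qed.

Lemma moebius_disk a u : cabs a < 1 -> cabs u < 1 -> cabs (moebius a u) < 1.
Proof.
move=> a1 u1; have d0 := moebius_denom _ _ a1 u1.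
rewrite cabsM cabsV ltr_pdivrMr ?cabs_gt0// mul1r.
rewrite -(@ltr_pXn2r _ 2) ?nnegrE ?cabs_ge0// -subr_gt0.
have sq z : cabs z < 1 -> 0 < 1 - cabs z ^+ 2.
  by move=> z1; rewrite subr_gt0 expr_lt1 ?cabs_ge0.
rewrite (_ : _ - _ = (1 - cabs a ^+ 2) * (1 - cabs u ^+ 2)) ?mulr_gt0 ?sq//.
by rewrite !cabs_sqr; case: (a) (u) => [x y] [p q] /=; ring.
Qed.

Lemma moebiusK a u : cabs a < 1 -> cabs u < 1 -> moebius (- a) (moebius a u) = u.
Proof.
move=> a1 u1; have := moebius_denom _ _ a1 u1; have := moebius_denom _ _ a1 a1.
rewrite /moebius rmorphN /=; move: (conjc a) => b h1 h2.
have h3 : 1 - b * u + b * (u - a) != 0 by rewrite (_ : _ + _ = 1 - b * a)//; ring.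
by field; rewrite h2 mulNr opprK h3.
Qed.

Lemma moebius_cderiv a u : cabs a < 1 -> cabs u < 1 ->
  exists l, has_cderiv (moebius a) u l.
Proof.
move=> a1 u1; apply/derivable_cderivP.
have did : derivable (fun v : Cplx R => v) u (1 : Cplx R) by exact: derivable_id.
have dcst (c : Cplx R) : derivable (fun _ : Cplx R => c) u (1 : Cplx R) by exact: derivable_cst.
apply: derivable_mul; first by apply: derivableB; [exact: did|exact: dcst].
apply: derivable_inv; first exact: moebius_denom.
apply: derivableB; first exact: dcst.
apply: derivable_mul; [exact: dcst|exact: did].
Qed.

Lemma pseudo_hypE z w : pseudo_hyp z w = cabs (moebius z w).
Proof. by rewrite /pseudo_hyp /moebius -cabsN -mulNr opprB. Qed.

(** Composing f with automorphisms that take 0 to z and f z to 0 gives a self-map F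
    that fixes 0, and the Schwarz lemma for F at the point [moebius z w] is the
    inequality for f. *)
Lemma Schwarz_Pick (f : Cplx R -> Cplx R) : holomorphic_on unit_disk f ->
  (forall z, unit_disk z -> unit_disk (f z)) ->
  forall z w, unit_disk z -> unit_disk w ->
  pseudo_hyp (f z) (f w) <= pseudo_hyp z w.
Proof.
move=> f_hol f_disk z w z1 w1; rewrite !pseudo_hypE.
have Nz1 : cabs (- z) < 1 by rewrite cabsN.
pose F u := moebius (f z) (f (moebius (- z) u)).
have -> : moebius (f z) (f w) = F (moebius z w) by rewrite /F moebiusK.
apply: (@Schwarz_lemma R F); last exact: moebius_disk.
- move=> u u1; have mu1 := moebius_disk _ _ Nz1 u1.
  have [m um] := moebius_cderiv _ _ Nz1 u1.
  have [l fl] := (derivable_cderivP f _).1 (f_hol _ mu1).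
  have [k mk] := moebius_cderiv _ _ (f_disk _ z1) (f_disk _ mu1).
  exists (k * (l * m)).
  exact: (has_cderiv_comp _ _ _ _ _ (has_cderiv_comp _ _ _ _ _ um fl) mk).
- move=> u u1; apply: ltW; apply: moebius_disk; first exact: f_disk.
  by apply: f_disk; exact: moebius_disk.
by rewrite /F /moebius mulr0 subr0 divr1 sub0r opprK subrr mul0r.
Qed.

Lemma pseudo_hyp_ge0 z w : 0 <= pseudo_hyp z w.
Proof. exact: cabs_ge0. Qed.

Lemma pseudo_hyp_le1 z w : unit_disk z -> unit_disk w -> pseudo_hyp z w <= 1.
Proof. by move=> z1 w1; rewrite pseudo_hypE ltW// moebius_disk. Qed.

(** A tuple in the image lifts to a tuple in E with larger product; the products
    are at most 1 on the disk, so the supremum over E is a true upper bound. *)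
Lemma hyp_diam_contraction (n : nat) (E : set (Cplx R)) (f : Cplx R -> Cplx R) :
  (2 <= n)%N -> E `<=` unit_disk ->
  (forall z w, E z -> E w -> pseudo_hyp (f z) (f w) <= pseudo_hyp z w) ->
  hyp_diam n (f @` E) <= hyp_diam n E.
Proof.
move=> n2 E1 f_contr.
have n1 : 1 <= n%:R :> R by rewrite ler1n ltnW.
have e0 : 0 <= 2 / (n%:R * (n%:R - 1)) :> R by rewrite divr_ge0// mulr_ge0; lra.
pose prod_of (w : 'I_n -> Cplx R) := \prod_(i < n) \prod_(j < n | (i < j)%N)
  pseudo_hyp (w i) (w j) `^ (2 / (n%:R * (n%:R - 1))).
rewrite /hyp_diam -/prod_of; have [->|/set0P[z0 Ez0]] := eqVneq E set0.
  by rewrite image_set0.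
apply: ge_sup; first by exists (prod_of (fun=> f z0)), (fun=> f z0) => //= _; exists z0.
move=> _ /= [w wE <-].
have /choice[v vP] : forall i, exists v, E v /\ f v = w i.
  by move=> i; have [v Ev fv] := wE i; exists v.
apply: (@le_trans _ _ (prod_of v)).
  apply: ler_prod => i _; apply/andP; split.
    by apply: prodr_ge0 => j _; exact: powR_ge0.
  apply: ler_prod => j _; rewrite powR_ge0/=.
  apply: ge0_ler_powR; rewrite ?nnegrE ?pseudo_hyp_ge0//.
  by have [Ei <-] := vP i; have [Ej <-] := vP j; exact: f_contr.
apply: ub_le_sup; last by exists v => // i; case: (vP i).
exists 1 => _ [u uE <-]; apply: prodr_ile1 => i _; apply/andP; split.
  by apply: prodr_ge0 => j _; exact: powR_ge0.
apply: prodr_ile1 => j _; rewrite powR_ge0/=.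
apply: (@le_trans _ _ (1 `^ (2 / (n%:R * (n%:R - 1))))); last by rewrite powR1.
apply: ge0_ler_powR; rewrite ?nnegrE ?pseudo_hyp_ge0//.
by apply: pseudo_hyp_le1; apply: E1.
Qed.

End SchwarzPick.

Theorem theorem1p4 (R : realType) (phi : R -> Cplx R -> Cplx R)
    (phi_sg : hol_semigroup phi) (phi_ne : non_elliptic phi)
    (Delta : set (Cplx R)) (Delta_petal : petal phi Delta)
    (K : set (Cplx R)) (K_compact : compact K) (K_sub : K `<=` Delta)
    (n : nat) (n_ge2 : (2 <= n)%N) (s t : R) (le_st : s <= t) (t_le0 : t <= 0) :
  hyp_diam n (petal_flow phi Delta t @` K)
    <= hyp_diam n (petal_flow phi Delta s @` K).
Proof.
have [[_ _ [z0 _ Delta_comp]] [_ [Delta_aut Delta_group] _]] := Delta_petal.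
have Delta_disk : Delta `<=` unit_disk.
  (* every point of the backward invariant set lies in the image of phi_0 = id *)
  move=> z; rewrite Delta_comp => /connected_component_sub /interior_subset Wz.
  have [w w1 <-] := Wz 0 (lexx 0).
  by rewrite (semigroup0 phi_sg).
have flow_Delta z : Delta z -> Delta (petal_flow phi Delta s z).
  by have [[fun_s _ _] _ _] := Delta_aut s; exact: fun_s.
have ts0 : 0 <= t - s by rewrite subr_ge0.
have -> : petal_flow phi Delta t @` K =
    phi (t - s) @` (petal_flow phi Delta s @` K).
  rewrite image_comp; apply: eq_imagel => z Kz /=.
  rewrite -{1}(subrK s t) Delta_group; last exact: K_sub.
  by rewrite {1}/petal_flow ts0.
apply: hyp_diam_contraction => //.
  by move=> _ [z Kz <-]; apply: Delta_disk; apply: flow_Delta; exact: K_sub.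
move=> _ _ [z Kz <-] [w Kw <-].
apply: Schwarz_Pick.
- exact: (semigroup_hol phi_sg).
- by move=> u; exact: (semigroup_disk phi_sg).
- by apply: Delta_disk; apply: flow_Delta; exact: K_sub.
- by apply: Delta_disk; apply: flow_Delta; exact: K_sub.
Qed.
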